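(* Let $\beta>1$ be a Pisot number, let $m>\beta$ be an integer, and let $\gamma=\gamma(\beta,m)>0$ be the constant such that $\lim_{n\to\infty}\frac1n\log\mathcal N_n(x;\beta)=\gamma$ for Lebesgue-a.e. $x\in I_\beta$. If $\beta$ is an integer such that $\beta$ divides $m$, then $\gamma=\log(m/\beta)$. Otherwise $\gamma<\log(m/\beta)$.
   Context: A Pisot number is an algebraic integer $\beta>1$ all of whose other Galois conjugates have modulus strictly less than $1$ (rational integers $\beta\ge2$ are included). For a real $\beta>1$ and an integer $m>\beta$, put $I_\beta=[0,\frac{m-1}{\beta-1}]$. For $x\in I_\beta$ let $\mathcal E_n(x;\beta)$ be the set of words $(\varepsilon_1,\dots,\varepsilon_n)\in\{0,1,\dots,m-1\}^n$ for which there exists $(\varepsilon_{n+1},\varepsilon_{n+2},\dots)\in\{0,1,\dots,m-1\}^{\mathbb N}$ with $x=\sum_{k=1}^\infty\varepsilon_k\beta^{-k}$, and let $\mathcal N_n(x;\beta)=\#\mathcal E_n(x;\beta)$. For $\beta$ Pisot, a constant $\gamma>0$ as in the claim exists (and is clearly unique); this is what $\gamma(\beta,m)$ denotes. *)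

(* Defs.v *)
From mathcomp Require Import all_boot all_order all_algebra.
From mathcomp Require Import complex.
From mathcomp Require Import all_classical all_reals all_analysis.
Import numFieldNormedType.Exports.
Import Order.TTheory GRing.Theory Num.Theory.

Set Implicit Arguments.
Unset Strict Implicit.
Unset Printing Implicit Defensive.

Local Open Scope classical_set_scope.
Local Open Scope ring_scope.

(* An irreducible rational polynomial vanishing at [x] is, up to a nonzero
   scalar, the minimal polynomial of [x] over the rationals. *)
Definition galois_conjugate (R : realType) (x z : R[i]) : Prop :=
  exists p : {poly rat},
    [/\ irreducible_poly p, root (map_poly ratr p) x
      & root (map_poly ratr p) z].

Definition pisot (R : realType) (beta : R) : Prop :=
  [/\ 1 < beta, integralOver (intr : int -> R) beta
    & forall z : R[i], galois_conjugate beta%:C%C z -> z != beta%:C%C ->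
        `|z| < 1].

(* Digits are indexed from 0: [e k] is the digit multiplying
   [beta ^- k.+1]. *)
Definition is_expansion (R : realType) (m : nat) (beta x : R)
    (e : nat -> 'I_m) : Prop :=
  series (fun k => (e k : nat)%:R * beta ^- k.+1) @ \oo --> x.

Definition expansion_words (R : realType) (m : nat) (beta : R) (n : nat)
    (x : R) : {set n.-tuple 'I_m} :=
  [set w : n.-tuple 'I_m |
    `[< exists e : nat -> 'I_m,
          (forall k : 'I_n, e k = tnth w k) /\ is_expansion beta x e >]]%SET.

Definition expansion_count (R : realType) (m : nat) (beta : R) (n : nat)
    (x : R) : nat := #|expansion_words m beta n x|.

Definition expansion_interval (R : realType) (m : nat) (beta : R) : set R :=
  [set` `[0, (m%:R - 1) / (beta - 1)]].

(* The value at [n = 0] (where [n%:R^-1 = 0]) is irrelevant to the limit. *)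
Definition is_growth_rate (R : realType) (beta : R) (m : nat) (gamma : R) :
    Prop :=
  {ae @lebesgue_measure R, forall x : R, expansion_interval m beta x ->
    (fun n => n%:R^-1 * ln (expansion_count m beta n x)%:R) @ \oo --> gamma}.

(* Main.v *)
Require Import Defs.
From mathcomp Require Import all_boot all_order all_algebra.
From mathcomp Require Import spectral complex.
From mathcomp Require Import zify ring lra.
From mathcomp Require Import all_classical all_reals all_analysis.
From mathcomp Require Import measurable_realfun.
Import numFieldNormedType.Exports.
Import Order.TTheory GRing.Theory Num.Theory.

(** Two words of the same length with the same value at beta begin expansions of
the same numbers. Let c(w) be the number of words of length n with the value
of w ([multiplicity]) and let H_n be the sum of c(w)^(-1/2) over all words of
length n ([affinity]). This sum controls the growth rate in two ways.
- It is submultiplicative, because c(uv) >= c(u) c(v) for a concatenation uv.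
- If E is the set of words beginning expansions of x, then every c(w) with w
  in E is at most #E, so the square root of #E is at most the sum over E of
  c(w)^(-1/2); and the x with w in E lie in an interval of length O(beta^-n).
  Integrating, Markov's inequality turns H_(jK) = O(Theta^j) into
  K gamma <= 2 ln (Theta / beta^K) ([growth_rate_upper_bound]).
Hence gamma <= ln (m / beta) follows from H_n = O((m beta)^(n/2)), and the
strict inequality follows from H_K < (m beta)^(K/2) for a single K.

The first of these bounds is the Cauchy-Schwarz inequality: there are m^n
words, and the sum of 1/c(w) is the number of distinct values. Distinct values
of words differ by at least a constant, because the norm of a nonzero
algebraic integer is at least 1 and all conjugates but beta contribute bounded
factors (Garsia). So there are O(beta^n) values ([affinity_bound]).

The second one is a quantitative form of Erdos' theorem that the Bernoulli
convolution of a Pisot number is singular ([affinity_strict_bound]). Powers of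
beta are exponentially close to integers. Therefore, unless beta is an integer
that divides m, the characters exp (2 i pi beta^-p x), averaged over the values
x of the words of length K, have means c_p bounded away from 0 uniformly in
p <= K; and they are nearly uncorrelated when their exponents are far apart. On an arithmetic progression
fine enough to separate the values, the same characters have mean about 0 and
are nearly orthogonal. So the average S of J characters weighted by
the conjugates of c_p is close in mean square to a constant kappa on words,
and close to 0 on the progression. Splitting
kappa H_K <= sum c^(-1/2) |kappa - S| + sum c^(-1/2) |S|
and applying the Cauchy-Schwarz inequality to both sums makes H_K small
compared with (m beta)^(K/2).

A mean c_p can only vanish if, for some integer j, m beta^j is an integer and
beta^j is not. As soon as beta has another conjugate, of modulus less than 1,
no power beta^j with j nonzero is rational; so beta would be an integer, and
it would divide m. In that case, m = b q with beta = b, every digit is d + b e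
with d < b and e < q. For 0 < x < 1 the digits e may be chosen freely from some rank
on, the radix-b expansion of what remains of x supplying the digits d, so that
the number of words grows at least like q^n ([radix_count_lower_bound]). *)

Set Implicit Arguments.
Unset Strict Implicit.
Unset Printing Implicit Defensive.

Local Open Scope ring_scope.

(** * Symmetric functions of the roots of a monic integer polynomial *)

Lemma trig_mx_mul (F : comNzRingType) n (S T : 'M[F]_n) :
  is_trig_mx S -> is_trig_mx T ->
  is_trig_mx (S *m T) /\ forall i, (S *m T) i i = S i i * T i i.
Proof.
move=> /is_trig_mxP trS /is_trig_mxP trT; split.
  apply/is_trig_mxP => i j ij; rewrite mxE big1 // => k _.
  have [ik|ki] := ltnP i k; first by rewrite trS ?mul0r.
  by rewrite [T k j]trT ?mulr0 //; apply: leq_ltn_trans ij.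
move=> i; rewrite mxE (bigD1 i) //= big1 ?addr0 // => k ki.
have [ik|ki'] := ltnP i k; first by rewrite trS ?mul0r.
by rewrite [T k i]trT ?mulr0 // ltn_neqAle ki' andbT.
Qed.

(** Triangular matrices carry their eigenvalues on the diagonal, so polynomial
    expressions in them are evaluated entrywise there. *)
Lemma trig_horner_mx (F : comNzRingType) n (T : 'M[F]_n.+1) (p : {poly F}) :
  is_trig_mx T ->
  is_trig_mx (horner_mx T p) /\ forall i, horner_mx T p i i = p.[T i i].
Proof.
move=> trT; elim/poly_ind: p => [|p c [trp dp]].
  by rewrite rmorph0; split=> [|i]; rewrite ?mx0_is_trig // mxE horner0.
rewrite rmorphD rmorphM /= horner_mx_X horner_mx_C.
rewrite -[horner_mx T p * T]/(horner_mx T p *m T).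
have [/is_trig_mxP trM dM] := trig_mx_mul trp trT; split.
  apply/is_trig_mxP => i j ij; rewrite [LHS]mxE trM // add0r.
  by rewrite mxE -val_eqE ltn_eqF.
move=> i; rewrite mxE dM dp mxE eqxx mulr1n.
by rewrite hornerD hornerMX hornerC.
Qed.

Lemma char_poly_conj (F : fieldType) n (P A : 'M[F]_n) :
  P \in unitmx -> char_poly (P *m A *m invmx P) = char_poly A.
Proof.
move=> uP; rewrite /char_poly /char_poly_mx !map_mxM /=.
set P' := map_mx _ P; set Q' := map_mx _ (invmx P).
have PQ : P' *m Q' = 1%:M by rewrite -map_mxM mulmxV // map_mx1.
have -> : 'X%:M - P' *m map_mx polyC A *m Q' =
    P' *m ('X%:M - map_mx polyC A) *m Q'.
  by rewrite mulmxBr mulmxBl; congr (_ - _); rewrite scalar_mxC -mulmxA PQ mulmx1.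
by rewrite !det_mulmx mulrAC -det_mulmx PQ det1 mul1r.
Qed.

(** The companion matrix M of q has integer entries, and over an algebraically
    closed field Schur's theorem makes it triangular with the roots of q on the
    diagonal. So the sum and the product are the trace and the determinant of
    the integer matrix A(M). *)
Lemma monic_roots_int (C : numClosedFieldType) (q : {poly int}) (zs : seq C)
    (A : {poly int}) :
  q \is monic -> map_poly intr q = \prod_(z <- zs) ('X - z%:P) ->
  (exists k : int, \sum_(z <- zs) (map_poly intr A).[z] = k%:~R) /\
  (exists k : int, \prod_(z <- zs) (map_poly intr A).[z] = k%:~R).
Proof.
move=> mq qzs.
have [zs0|zsN0] := eqVneq zs [::].
  by rewrite zs0 !big_nil; split; [exists 0 | exists 1].
have sq : size q = (size zs).+1.
  rewrite -(size_prod_XsubC zs (fun z => z)) -qzs size_map_inj_poly //.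
  exact: intr_inj.
have [n sn] : exists n, (size q).-1 = n.+1.
  by rewrite sq /=; case: zs zsN0 {sq qzs} => // a l _; exists (size l).
have : char_poly (companionmx q) = q by exact: companionmxK.
move: (companionmx q); rewrite sn => M chM.
pose MC := map_mx (intr : int -> C) M.
have chMC : char_poly MC = \prod_(z <- zs) ('X - z%:P).
  by rewrite -qzs -[in RHS]chM map_char_poly.
(* Schur's theorem over the complex field: P M P^-1 = T is triangular. *)
have [P /unitarymx_unit uP] := @Schur C n.+1 MC isT.
rewrite /similar_to conjumx //; set T := _ *m _ => trT.
have {}trT : is_trig_mx T by [].
have chT : char_poly T = \prod_(z <- zs) ('X - z%:P).
  by rewrite -chMC char_poly_conj.
have zsE : perm_eq [seq T i i | i <- enum 'I_n.+1] zs.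
  apply: prod_XsubC_eq; rewrite -chT char_poly_trig // big_map big_enum //=.
pose B := map_poly (intr : int -> C) A.
have [/is_trig_mxP trB dB] := trig_horner_mx B trT.
have hM : horner_mx MC B = map_mx intr (horner_mx M A).
  by rewrite map_horner_mx.
have hT : horner_mx T B = P *m horner_mx MC B *m invmx P.
  by rewrite -horner_mx_uconj.
split.
  exists (\tr (horner_mx M A)).
  rewrite -(perm_big _ zsE) /= big_map big_enum /=.
  transitivity (\tr (horner_mx T B)); first by apply: eq_bigr => i _; rewrite dB.
  by rewrite hT mxtrace_mulC mulmxA mulVmx // mul1mx hM; exact: trace_map_mx.
exists (\det (horner_mx M A)).
rewrite -(perm_big _ zsE) /= big_map big_enum /=.
transitivity (\det (horner_mx T B)).
  rewrite det_trig; first by apply: eq_bigr => i _; rewrite dB.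
  exact/is_trig_mxP.
rewrite hT !det_mulmx mulrAC -det_mulmx mulmxV // det1 mul1r hM.
exact: det_map_mx.
Qed.

(** * Conjugates of a Pisot number *)

(** A nonzero annihilating polynomial of least degree is irreducible, and
    dividing by it leaves a remainder that must vanish. *)
Lemma minimal_rat_poly (C : numFieldType) (x : C) (p : {poly rat}) :
  p != 0 -> root (map_poly ratr p) x ->
  exists q : {poly rat}, [/\ irreducible_poly q, root (map_poly ratr q) x &
    forall A : {poly rat}, root (map_poly ratr A) x -> q %| A].
Proof.
move=> p0 px.
pose P n := `[< exists q : {poly rat},
  [/\ q != 0, root (map_poly ratr q) x & size q = n] >].
have exP : exists n, P n by exists (size p); apply/asboolP; exists p.
case: (ex_minnP exP) => n /asboolP[q [q0 qx sq]] minn.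
have {}minn (A : {poly rat}) : A != 0 -> root (map_poly ratr A) x ->
    (size q <= size A)%N.
  by move=> A0 Ax; rewrite sq; apply: minn; apply/asboolP; exists A.
exists q; split => //; last first.
  move=> A Ax; rewrite /dvdp; apply/negPn/negP => r0.
  have := minn _ r0; rewrite leqNgt ltn_modp q0 => /(_ _)/negP; apply => //.
  move: Ax; rewrite [X in map_poly _ X](divp_eq A q) /root rmorphD rmorphM /=.
  by rewrite hornerD hornerM (rootP qx) mulr0 add0r.
have sq1 : (1 < size q)%N.
  by rewrite -(size_map_poly (ratr : rat -> C)); apply: root_size_gt1 qx;
     rewrite map_poly_eq0.
split=> // d sd dq; have d0 : d != 0 by apply: contraNneq q0 => d0;
  move: dq; rewrite d0 dvd0p.
move/dvdpP: (dq) => [e qE].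
have e0 : e != 0 by apply: contraNneq q0 => e0; rewrite qE e0 mul0r.
have sz : size q = (size e + size d).-1 by rewrite qE size_mul.
move: qx; rewrite qE rmorphM rootM => /orP[/(minn _ e0)|/(minn _ d0)].
  rewrite sz; move: sd d0 e0; rewrite -!size_poly_gt0.
  move: (size d) (size e) => k l /eqP k1 k0 l0 kl; exfalso; lia.
by rewrite -qE => le; rewrite -dvdp_size_eqp // eqn_leq le dvdp_leq.
Qed.

(** Used to see that beta is a simple root of its minimal polynomial. *)
Lemma root_deriv_double (F : comNzRingType) (x : F) (r : {poly F}) :
  root r x -> root (('X - x%:P) * r)^`() x.
Proof.
move=> rx; rewrite /root derivM derivXsubC mul1r !hornerE subrr mul0r addr0.
exact: rx.
Qed.

(** All that is needed about the conjugates of beta other than beta itself. By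
    Gauss' lemma the monic minimal polynomial of beta over the rationals has
    integer coefficients, so that [monic_roots_int] applies to it;
    irreducibility makes an integer polynomial vanish at all the conjugates as
    soon as it vanishes at one. *)
Lemma pisot_conjugates (R : realType) (beta : R) : pisot beta ->
  exists rest : seq R[i],
    [/\ {in rest, forall z, `|z| < 1},
        forall A : {poly int}, root (map_poly intr A) beta%:C%C ->
          {in rest, forall z, root (map_poly intr A) z},
        forall A : {poly int}, {in rest, forall z,
          root (map_poly intr A) z -> root (map_poly intr A) beta%:C%C},
        forall A : {poly int},
          (exists k : int, \sum_(z <- beta%:C%C :: rest)
             (map_poly intr A).[z] = k%:~R) /\
          (exists k : int, \prod_(z <- beta%:C%C :: rest)
             (map_poly intr A).[z] = k%:~R)
      & rest = [::] -> exists b : nat, beta = b%:R].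
Proof.
move=> [beta1 [p mp pb] conj1].
set x := beta%:C%C.
pose pQ := map_poly (intr : int -> rat) p.
have QC (A : {poly int}) : map_poly (ratr : rat -> R[i]) (map_poly intr A) =
    map_poly intr A.
  by rewrite -map_poly_comp; apply: eq_map_poly => k /=; rewrite ratr_int.
have pQ0 : pQ != 0 by rewrite map_poly_eq0_id0 ?monic_neq0 // (monicP mp).
have pQx : root (map_poly ratr pQ) x.
  rewrite QC (_ : map_poly intr p = map_poly (fun y : R => y%:C%C) (map_poly intr p)).
    by rewrite /root horner_map /= (rootP pb).
  by rewrite -map_poly_comp; apply: eq_map_poly => k /=; rewrite rmorph_int.
have [q [irrq qx minq]] := minimal_rat_poly pQ0 pQx.
have [p1 [a a0 qE] [r pE]] := dvdpP_rat_int (minq _ pQx).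
(* Gauss' lemma: p1 has integer coefficients and is proportional to the minimal
   polynomial; its leading coefficient divides 1. *)
have : lead_coef p1 * lead_coef r = 1 by rewrite -lead_coefM -pE (monicP mp).
have p1E : map_poly intr p1 = a^-1 *: q by rewrite qE scalerA mulVf // scale1r.
move=> l1; pose l := lead_coef p1; pose q0 := l *: p1.
have ll : l * l = 1.
  have /eqP := congr1 absz l1; rewrite abszM muln_eq1 => /andP[/eqP l_1 _].
  by have [->|->] : l = 1 \/ l = -1 by rewrite /l; lia.
have mq0 : q0 \is monic by rewrite monicE lead_coefZ -/l ll.
pose b := a^-1 * l%:~R.
have b0 : b != 0.
  rewrite mulf_neq0 ?invr_eq0 // intr_eq0; apply/eqP => l0.
  by move: ll; rewrite l0 mul0r.
have q0E : map_poly intr q0 = b *: q.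
  by rewrite /q0 map_polyZ p1E scalerA mulrC.
have q0q (z : R[i]) : root (map_poly intr q0) z = root (map_poly ratr q) z.
  by rewrite -QC q0E map_polyZ rootZ // fmorph_eq0.
have [zs] := closed_field_poly_normal (map_poly (intr : int -> R[i]) q0).
rewrite (_ : lead_coef _ = 1) ?scale1r; last first.
  by rewrite lead_coef_map_inj ?(monicP mq0) //; apply: intr_inj.
move=> q0zs.
have zsP (z : R[i]) : (z \in zs) = root (map_poly ratr q) z.
  by rewrite -q0q q0zs root_prod_XsubC.
have xzs : x \in zs by rewrite zsP.
have pzs := perm_to_rem xzs; exists (rem x zs).
have q0E' : map_poly intr q0 = ('X - x%:P) * \prod_(z <- rem x zs) ('X - z%:P).
  by rewrite q0zs (perm_big _ pzs) /= big_cons.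
have q_dvd (A : {poly int}) : root (map_poly intr A) x -> q %| map_poly intr A.
  by move=> Ax; apply: minq; rewrite QC.
(* beta is a simple root: otherwise the derivative of its minimal polynomial
   would vanish at beta. *)
have xnr : x \notin rem x zs.
  apply/negP => xr.
  have dx : root (map_poly ratr (map_poly intr q0)^`()) x.
    rewrite -deriv_map QC q0E'; apply: root_deriv_double.
    by rewrite root_prod_XsubC.
  have q00 : q^`() != 0.
    apply/eqP => /(congr1 (fun f : {poly rat} => f`_(size q).-2)).
    rewrite coef_deriv coef0; have [sq _] := irrq.
    rewrite -[X in q`_X](_ : (size q).-1 = _); last by case: (size q) sq => [|[]].
    move/eqP; rewrite mulrn_eq0 -lead_coefE lead_coef_eq0.
    by rewrite (negPf (irredp_neq0 irrq)).
  move: (minq _ dx); rewrite q0E derivZ dvdpZr //.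
  move/(dvdp_leq q00); rewrite leqNgt lt_size_deriv //; exact: irredp_neq0.
split.
- move=> z zr; apply: conj1; last by apply/eqP => zx; move: zr; rewrite zx (negPf xnr).
  by exists q; split => //; rewrite -zsP; apply: mem_rem zr.
- move=> A /q_dvd qA z /mem_rem; rewrite zsP => qz.
  have /dvdpP[e eA] := qA.
  by rewrite -QC eA rmorphM rootM qz orbT.
- move=> A z /mem_rem; rewrite zsP => qz Az.
  (* Either A is coprime to the minimal polynomial, and Bezout's identity is
     violated at z, or the minimal polynomial divides A. *)
  have [sg|sg] := eqVneq (size (gcdp q (map_poly intr A))) 1.
    have /Bezout_coprimepP[[u v]] : coprimep q (map_poly intr A).
      by rewrite /coprimep sg.
    rewrite /= => /eqp_size; rewrite size_poly1 => /eqP/size_poly1P[c c0 E].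
    have : (map_poly ratr (u * q + v * map_poly intr A)).[z] = 0 :> R[i].
      by rewrite rmorphD !rmorphM /= hornerD !hornerM QC (rootP qz) (rootP Az)
         !mulr0 addr0.
    by rewrite E map_polyC hornerC /= => /eqP; rewrite fmorph_eq0 (negPf c0).
  have := irrq.2 _ sg (dvdp_gcdl _ _); rewrite /eqp => /andP[_ qg].
  have /dvdpP[e eA] := dvdp_trans qg (dvdp_gcdr _ _).
  by rewrite -QC eA rmorphM rootM qx orbT.
- move=> A; apply: (monic_roots_int A mq0).
  by rewrite big_cons.
- move=> r0; move: q0E'; rewrite r0 big_nil mulr1.
  move/(congr1 (fun f : {poly R[i]} => f`_0)); rewrite coef_map /= coefB coefX coefC /=.
  rewrite sub0r => E.
  have Eb : beta = (- q0`_0)%:~R.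
    by apply: (@complexI R); rewrite rmorph_int rmorphN /= E opprK.
  move: Eb beta1; case: (- q0`_0) => [n|n] -> h; first by exists n.
  by move: h; rewrite ltNge NegzE (le_trans (_ : _ <= 0)) // ?ler01 // lerz0.
Qed.

(** * Arithmetic of Pisot numbers *)

(** The modulus of a complex number as an element of the real field, whereas
    the norm of [R[i]] takes its values in [R[i]]. *)
Definition cnorm (R : rcfType) (z : R[i]) : R := ComplexField.Normc.normc z.

Section ComplexNorm.
Variable R : rcfType.
Implicit Types (x y z : R[i]).

Lemma cnormE z : `|z| = (cnorm z)%:C%C. Proof. by []. Qed.

Lemma cnormM x y : cnorm (x * y) = cnorm x * cnorm y.
Proof. exact: ComplexField.Normc.normcM. Qed.

Lemma cnorm0 : cnorm (0 : R[i]) = 0.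
Proof. exact: ComplexField.Normc.normc0. Qed.

Lemma cnorm1 : cnorm (1 : R[i]) = 1.
Proof. exact: ComplexField.Normc.normc1. Qed.

Lemma cnorm_ge0 z : 0 <= cnorm z.
Proof. by rewrite -ler0c -cnormE. Qed.

Lemma cnormD x y : cnorm (x + y) <= cnorm x + cnorm y.
Proof. exact: le_normcD. Qed.

Lemma cnormN x : cnorm (- x) = cnorm x.
Proof. exact: normcN. Qed.

Lemma cnormB x y : cnorm (x - y) <= cnorm x + cnorm y.
Proof. by rewrite -[cnorm y]cnormN; apply: cnormD. Qed.

Lemma cnorm_distC x y : cnorm (x - y) = cnorm (y - x).
Proof. by rewrite -cnormN opprB. Qed.

Lemma cnorm_real (a : R) : cnorm a%:C%C = `|a|.
Proof. by rewrite /cnorm /= expr0n /= addr0 sqrtr_sqr. Qed.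

Lemma cnorm_natV (n : nat) : cnorm (n%:R^-1 : R[i]) = n%:R^-1.
Proof.
rewrite -(rmorph_nat (real_complex R)) -fmorphV cnorm_real.
by rewrite ger0_norm ?invr_ge0.
Qed.

Lemma cnorm_conj x : cnorm (x^*)%C = cnorm x.
Proof. by apply: (@complexI R); rewrite -!cnormE normcJ. Qed.

Lemma cnorm_sqr x : (cnorm x ^+ 2)%:C%C = x * (x^*)%C.
Proof. by rewrite rmorphXn /= -cnormE sqr_normc. Qed.

Lemma cnormX x n : cnorm (x ^+ n) = cnorm x ^+ n.
Proof. by elim: n => [|n IH]; rewrite ?expr0 ?cnorm1 // !exprS cnormM IH. Qed.

Lemma cnorm_prod I (r : seq I) (P : pred I) (F : I -> R[i]) :
  cnorm (\prod_(i <- r | P i) F i) = \prod_(i <- r | P i) cnorm (F i).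
Proof. exact: (big_morph _ cnormM cnorm1). Qed.

Lemma cnorm_sum I (r : seq I) (P : pred I) (F : I -> R[i]) :
  cnorm (\sum_(i <- r | P i) F i) <= \sum_(i <- r | P i) cnorm (F i).
Proof.
apply: (big_rec2 (fun (a : R[i]) b => cnorm a <= b)); first by rewrite cnorm0.
by move=> i a b _ ab; apply: le_trans (cnormD _ _) _; rewrite lerD2l.
Qed.

End ComplexNorm.

Lemma geom_sum_le (R : realFieldType) (r : R) n : 0 <= r < 1 ->
  \sum_(i < n) r ^+ i <= (1 - r)^-1.
Proof.
move=> /andP[r0 r1]; rewrite -[leRHS]mul1r ler_pdivlMr ?subr_gt0 //.
rewrite mulrC -opprB mulNr -subrX1 opprB gerBl exprn_ge0 //.
Qed.

Lemma seq_sup_lt1 (T : eqType) (R : realFieldType) (f : T -> R) (s : seq T) :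
  {in s, forall z, 0 <= f z < 1} ->
  exists2 r : R, 0 < r < 1 & {in s, forall z, f z <= r}.
Proof.
elim: s => [|z s IH] H; first by exists 2^-1 => //; lra.
have [u us|r /andP[r0 r1] rP] := IH; first by apply: H; rewrite inE us orbT.
have /andP[f0 f1] := H z (mem_head _ _).
exists (Num.max r (f z)); first by rewrite lt_max r0 gt_max r1 f1.
by move=> u; rewrite inE le_max => /orP[/eqP ->|/rP ->]; rewrite ?lexx ?orbT.
Qed.

Section PisotArithmetic.
Variables (R : realType) (beta : R).
Hypothesis beta_pisot : pisot beta.

Lemma pisot_gt1 : 1 < beta. Proof. by case: beta_pisot. Qed.

Lemma horner_real_int (A : {poly int}) :
  (map_poly intr A).[beta%:C%C] = ((map_poly intr A).[beta])%:C%C.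
Proof.
rewrite (_ : map_poly intr A =
    map_poly (fun y : R => y%:C%C) (map_poly intr A)) ?horner_map //=.
by rewrite -map_poly_comp; apply: eq_map_poly => k /=; rewrite rmorph_int.
Qed.

(** The sum of the n-th powers of all the conjugates is an integer, and all of
    them but beta contribute exponentially small terms. *)
Lemma pisot_near_int : exists (C r : R), [/\ 0 < r < 1, 0 <= C &
  forall n : nat, exists k : int, `|beta ^+ n - k%:~R| <= C * r ^+ n].
Proof.
have [rest [lt1 _ _ sums _]] := pisot_conjugates beta_pisot.
have [r r01 rP] : exists2 r : R, 0 < r < 1 & {in rest, forall z, cnorm z <= r}.
  by apply: seq_sup_lt1 => z /lt1; rewrite cnormE cnorm_ge0 -ltcR.
exists (size rest)%:R, r; split => // n.
have [[k E] _] := sums 'X^n; exists k.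
rewrite -cnorm_real rmorphB rmorphXn rmorph_int /= -E map_polyXn big_cons.
rewrite hornerXn opprD addrA subrr sub0r cnormN.
apply: le_trans (cnorm_sum _ _ _) _.
rewrite mulr_natl -[size rest](count_predT rest) -iter_addr_0 -big_const_seq.
rewrite big_seq [leRHS]big_seq; apply: ler_sum => z zr.
rewrite hornerXn cnormX lerXn2r ?nnegrE ?cnorm_ge0 //.
- by case/andP: r01 => /ltW.
- exact: rP.
Qed.

(** The product of the A(z) over all the conjugates z of beta is a nonzero
    integer, and |A(z)| is bounded by a geometric series when |z| < 1. The bound
    does not depend on the degree of A. *)
Lemma pisot_int_poly_lower_bound (m : nat) : exists2 s : R, 0 < s &
  forall A : {poly int}, (forall i, `|A`_i| <= m%:Z) ->
    (map_poly intr A).[beta] != 0 -> s <= `|(map_poly intr A).[beta]|.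
Proof.
have [rest [lt1 toRest fromRest prods _]] := pisot_conjugates beta_pisot.
have [r /andP[r0 r1] rP] :
    exists2 r : R, 0 < r < 1 & {in rest, forall z, cnorm z <= r}.
  by apply: seq_sup_lt1 => z /lt1; rewrite cnormE cnorm_ge0 -ltcR.
pose B := m.+1%:R / (1 - r).
have B0 : 0 < B by rewrite divr_gt0 ?ltr0n // subr_gt0.
exists (B ^- size rest); first by rewrite invr_gt0 exprn_gt0.
move=> A Am A0.
have boundA z : z \in rest -> cnorm (map_poly intr A).[z] <= B.
  move=> zr; rewrite horner_coef; apply: le_trans (cnorm_sum _ _ _) _.
  apply: (@le_trans _ _ (\sum_(i < size (map_poly intr A : {poly R[i]}))
      m.+1%:R * r ^+ i)).
    apply: ler_sum => i _; rewrite cnormM cnormX coef_map /=.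
    apply: ler_pM; rewrite ?exprn_ge0 ?cnorm_ge0 //; last first.
      by rewrite lerXn2r ?nnegrE ?cnorm_ge0 ?(ltW r0) // rP.
    rewrite -(rmorph_int (real_complex R)) cnorm_real -intr_norm.
    apply: (@le_trans _ _ (m%:Z)%:~R); first by rewrite ler_int Am.
    by rewrite -pmulrn ler_nat.
  by rewrite -mulr_sumr ler_wpM2l // geom_sum_le // (ltW r0) r1.
have [_ [k E]] := prods A.
have k0 : k != 0.
  apply/eqP => k0; move/eqP: E; rewrite k0 prodf_seq_eq0 => /hasP[z].
  rewrite inE /= => zr /eqP Az; case/negP: A0.
  rewrite -(inj_eq (@complexI R)) -horner_real_int.
  case/orP: zr => [/eqP <-|zr]; first by rewrite Az.
  exact: (fromRest _ _ zr (introT eqP Az)).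
have := congr1 (@cnorm R) E; rewrite big_cons cnormM cnorm_prod horner_real_int.
rewrite cnorm_real -(rmorph_int (real_complex R)) cnorm_real => E'.
have k1 : 1 <= `|k%:~R : R| by rewrite -intr_norm ler1z; lia.
have B1 : \prod_(z <- rest) cnorm (map_poly intr A).[z] <= B ^+ size rest.
  rewrite -[size rest](count_predT rest) -iter_mulr_1 -big_const_seq big_seq.
  rewrite [leRHS]big_seq.
  by apply: ler_prod => z zr; rewrite cnorm_ge0 boundA.
rewrite -[_ ^- _]mul1r ler_pdivrMr ?exprn_gt0 //.
by apply: le_trans k1 _; rewrite -E' ler_wpM2l.
Qed.

(** If l beta^j = k, every other conjugate z satisfies l z^j = k too, so that
    |z|^j = beta^j > 1 although |z| < 1. So there is no other conjugate. *)
Lemma pisot_pow_rational (j : nat) (k l : int) : (0 < j)%N -> l != 0 ->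
  l%:~R * beta ^+ j = k%:~R -> exists b : nat, beta = b%:R.
Proof.
have [rest [lt1 toRest _ _ nil]] := pisot_conjugates beta_pisot.
move=> j0 l0 E; apply: nil; case: rest lt1 toRest => // z rest lt1 toRest.
have Ec : l%:~R * beta%:C%C ^+ j = k%:~R :> R[i].
  by rewrite -rmorphXn -!(rmorph_int (real_complex R)) -rmorphM E.
have Apoly (x : R[i]) :
    root (map_poly intr (l *: 'X^j - k%:P)) x = (l%:~R * x ^+ j == k%:~R).
  by rewrite /root rmorphB /= map_polyZ map_polyXn map_polyC /= !hornerE subr_eq0.
have := toRest (l *: 'X^j - k%:P); rewrite Apoly Ec eqxx => /(_ isT z (mem_head _ _)).
rewrite Apoly -Ec => /eqP/mulfI; rewrite intr_eq0 => /(_ l0)/(congr1 (@cnorm R)).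
rewrite !cnormX cnorm_real => zb.
have z1 : cnorm z < 1 by rewrite -ltcR -cnormE; apply/lt1/mem_head.
have := exprn_ilt1 j (cnorm_ge0 z) z1; rewrite -lt0n j0 zb.
rewrite ger0_norm ?(le_trans ler01) ?(ltW pisot_gt1) //.
by rewrite ltNge exprn_ege1 ?(ltW pisot_gt1).
Qed.

End PisotArithmetic.

(** * Words, their values and multiplicities *)

Section Words.
Variables (R : realType) (beta : R) (m : nat).
Implicit Types n k : nat.

Definition word_value n (w : n.-tuple 'I_m) : R :=
  \sum_(i < n) (tnth w i : nat)%:R * beta ^+ (n - i.+1).

Definition multiplicity n (w : n.-tuple 'I_m) : nat :=
  #|[set u : n.-tuple 'I_m | word_value u == word_value w]%SET|.

(** Up to normalization, the Hellinger affinity between the law of the value of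
    a uniform word and the counting measure on the set of values. *)
Definition affinity n : R :=
  \sum_(w : n.-tuple 'I_m) (Num.sqrt (multiplicity w)%:R)^-1.

Lemma multiplicity_gt0 n (w : n.-tuple 'I_m) : (0 < multiplicity w)%N.
Proof. by apply/card_gt0P; exists w; rewrite inE. Qed.

Lemma affinity_ge0 n : 0 <= affinity n.
Proof. by apply: sumr_ge0 => w _; rewrite invr_ge0 sqrtr_ge0. Qed.

Definition word_cat n k (u : n.-tuple 'I_m) (v : k.-tuple 'I_m) :
    (n + k).-tuple 'I_m :=
  [tuple match fintype.split i with inl a => tnth u a | inr b => tnth v b end
    | i < n + k].

Lemma word_catl n k (u : n.-tuple 'I_m) (v : k.-tuple 'I_m) (i : 'I_n) :
  tnth (word_cat u v) (lshift k i) = tnth u i.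
Proof. by rewrite tnth_mktuple (unsplitK (inl i)). Qed.

Lemma word_catr n k (u : n.-tuple 'I_m) (v : k.-tuple 'I_m) (i : 'I_k) :
  tnth (word_cat u v) (rshift n i) = tnth v i.
Proof. by rewrite tnth_mktuple (unsplitK (inr i)). Qed.

Lemma word_value_cat n k (u : n.-tuple 'I_m) (v : k.-tuple 'I_m) :
  word_value (word_cat u v) = word_value u * beta ^+ k + word_value v.
Proof.
rewrite /word_value big_split_ord mulr_suml /=; congr (_ + _).
  apply: eq_bigr => i _; rewrite word_catl -mulrA -exprD; congr (_ * _ ^+ _).
  by case: i => i /=; lia.
apply: eq_bigr => i _; rewrite word_catr; congr (_ * _ ^+ _).
by case: i => i /=; lia.
Qed.

Lemma word_cat_bij n k : bijective (fun p : n.-tuple 'I_m * k.-tuple 'I_m =>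
  word_cat p.1 p.2).
Proof.
exists (fun w : (n + k).-tuple 'I_m => ([tuple tnth w (lshift k i) | i < n],
  [tuple tnth w (rshift n i) | i < k])).
  case=> u v /=; congr (_, _); apply: eq_from_tnth => i.
    by rewrite tnth_mktuple word_catl.
  by rewrite tnth_mktuple word_catr.
move=> w; apply: eq_from_tnth => i /=; rewrite -(splitK i).
by case: (fintype.split i) => a /=; rewrite ?word_catl ?word_catr tnth_mktuple.
Qed.

(** Replacing each half of a word by one of the same value keeps the value. *)
Lemma multiplicity_cat n k (u : n.-tuple 'I_m) (v : k.-tuple 'I_m) :
  (multiplicity u * multiplicity v <= multiplicity (word_cat u v))%N.
Proof.
rewrite /multiplicity -cardsX -(card_imset _ (bij_inj (@word_cat_bij n k))).
apply/subset_leq_card/fintype.subsetP => _ /imsetP[[a b] abI ->].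
move: abI; rewrite !inE => /andP[/= /eqP ua /eqP vb].
by rewrite !word_value_cat ua vb.
Qed.

Lemma affinity_submul n k : affinity (n + k) <= affinity n * affinity k.
Proof.
rewrite /affinity (reindex _ (onW_bij _ (@word_cat_bij n k))) /=.
rewrite big_distrlr pair_bigA /=; apply: ler_sum => -[u v] _ /=.
rewrite -invfM -sqrtrM ?ler0n // lef_pV2 ?posrE; last 2 first.
- by rewrite sqrtr_gt0 ltr0n multiplicity_gt0.
- by rewrite sqrtr_gt0 -natrM ltr0n muln_gt0 !multiplicity_gt0.
by rewrite ler_wsqrtr // -natrM ler_nat multiplicity_cat.
Qed.

Lemma affinity_iter n j : affinity (j * n) <= affinity n ^+ j.
Proof.
elim: j => [|j IH].
  rewrite mul0n expr0 /affinity; under eq_bigr => w _.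
    rewrite (_ : multiplicity w = 1%N).
      rewrite sqrtr1 invr1; over.
    apply/eqP/cards1P; exists w; apply/setP => u; rewrite !inE.
    by have -> : u = w; [rewrite [u]tuple0 [w]tuple0 | rewrite !eqxx].
  by rewrite sumr_const card_tuple expn0.
rewrite mulSn exprS; apply: le_trans (affinity_submul _ _) _.
by rewrite ler_wpM2l // affinity_ge0.
Qed.

Hypothesis beta1 : 1 < beta.

(** Partial sums beyond rank n depend on the first n digits only through the
    value of the prefix. *)
Lemma series_prefix n (w : n.-tuple 'I_m) (e : nat -> 'I_m) (j : nat) :
  (forall k : 'I_n, e k = tnth w k) ->
  series (fun k => (e k : nat)%:R * beta ^- k.+1) (n + j)%N =
    beta ^- n * (word_value w +
      \sum_(k < j) (e (n + k)%N : nat)%:R * beta ^- k.+1).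
Proof.
have b0 : beta != 0 by rewrite gt_eqF // (lt_trans ltr01).
move=> ew; rewrite /series /= big_mkord big_split_ord mulrDr !mulr_sumr /=.
congr (_ + _); apply: eq_bigr => i _.
  rewrite ew mulrCA; congr (_ * _).
  have -> : beta ^+ n = beta ^+ (n - i.+1) * beta ^+ i.+1 :> R.
    by rewrite -exprD subnK.
  by rewrite invfM mulrAC mulVf ?mul1r // expf_neq0.
by rewrite mulrCA -invfM -exprD addnS.
Qed.

End Words.

(** * Lebesgue measure of superlevel sets *)

Section MeasureBounds.
Local Open Scope classical_set_scope.

(** The points that lie in all [B j] from rank J on form a set contained in
    arbitrarily small sets; the union over J stays negligible. *)
Lemma negligible_of_small_cover (R : realType) (A : set R) (c r : R)
    (B : nat -> set R) :
  `|r| < 1 -> (forall j, measurable (B j)) ->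
  (forall j, (lebesgue_measure (B j) <= (c * r ^+ j)%:E)%E) ->
  (forall x, A x -> \forall j \near \oo, B j x) ->
  lebesgue_measure.-negligible A.
Proof.
move=> r1 mB muB AB.
have : lebesgue_measure.-negligible
    (\bigcup_J \bigcap_(j in [set j | (J <= j)%N]) B j); last first.
  by apply: negligibleS => x /AB[J _ HJ]; exists J => // j /= Jj; apply: HJ.
apply: negligible_bigcup => J.
have mD : measurable (\bigcap_(j in [set j | (J <= j)%N]) B j).
  by apply: bigcap_measurable => //; exists J => /=.
apply/negligibleP => //; apply/eqP; rewrite eq_le measure_ge0 andbT.
apply/lee_addgt0Pr => e e0; rewrite add0e.
have : c * r ^+ j @[j --> \oo] --> (c * 0 : R).
  by apply: cvgMr; apply: cvg_expr.
rewrite mulr0 => /cvgrPdist_le /(_ _ e0)[j0 _ Hj0].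
pose j := maxn J j0.
apply: (@le_trans _ _ (lebesgue_measure (B j))).
  apply: le_measure; [by rewrite inE | by rewrite inE; apply: mB |].
  by move=> x; apply; rewrite /= leq_maxl.
apply: le_trans (muB j) _; rewrite lee_fin.
have := Hj0 j (leq_maxr _ _); rewrite sub0r normrN; apply: le_trans.
exact: ler_norm.
Qed.

(** Markov's inequality for a step function with overlapping intervals. *)
Lemma lebesgue_superlevel_step (R : realType) (I : finType) (a : I -> R)
    (lo len : I -> R) (t : R) :
  0 < t -> (forall i, 0 <= a i) -> (forall i, 0 <= len i) ->
  let B := [set x : R | t <= \sum_i a i * \1_(`[lo i, lo i + len i]%classic) x] in
  measurable B /\
  (lebesgue_measure B <= (t^-1 * \sum_i a i * len i)%:E)%E.
Proof.
move=> t0 a0 len0; pose f x := \sum_i a i * \1_(`[lo i, lo i + len i]%classic) x.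
have mf1 i : measurable_fun setT
    (fun x : R => a i * \1_(`[lo i, lo i + len i]%classic) x).
  by apply: measurable_funM => //; apply: measurable_indic.
have mf : measurable_fun setT f.
  by apply: measurable_sum => i; apply: mf1.
move=> B; have mB : measurable B.
  rewrite (_ : B = setT `&` f @^-1` `[t, +oo[%classic).
    by apply: mf => //; apply: measurable_itv.
  by rewrite setTI; apply/seteqP; split=> x /=; rewrite in_itv /= andbT.
split => //.
have len_itv i : lebesgue_measure (`[lo i, lo i + len i]%classic : set R) =
    (len i)%:E.
  rewrite lebesgue_measure_itv /= lte_fin.
  case: ifPn => [_|]; first by rewrite -EFinB addrAC subrr add0r.
  by rewrite -leNgt gerDl => h; have -> : len i = 0 by apply/eqP; rewrite eq_le h len0.
have int1 i : (\int[lebesgue_measure]_x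
    (a i * \1_(`[lo i, lo i + len i]%classic) x)%:E = (a i * len i)%:E)%E.
  under eq_integral do rewrite EFinM.
  rewrite ge0_integralZl //; last 2 first.
  - by apply/measurable_EFinP; apply: measurable_indic.
  - by rewrite lee_fin.
  rewrite integral_indic // setIT EFinM; congr (_ * _)%E; exact: len_itv.
have intf : (\int[lebesgue_measure]_x (f x)%:E = (\sum_i a i * len i)%:E)%E.
  rewrite -sumEFin -(eq_bigr _ (fun i _ => int1 i)) -ge0_integral_sum //.
  - by apply: eq_integral => x _; rewrite sumEFin.
  - by move=> i; apply/measurable_EFinP; apply: mf1.
  - by move=> i x _; rewrite lee_fin mulr_ge0.
have : (t%:E * lebesgue_measure B <= (\sum_i a i * len i)%:E)%E.
  have muB : lebesgue_measure B = (\int[lebesgue_measure]_x (\1_B x)%:E)%E.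
    by rewrite integral_indic // setIT.
  rewrite -intf muB -ge0_integralZl //; last 2 first.
  - by apply/measurable_EFinP; apply: measurable_indic.
  - by rewrite lee_fin ltW.
  apply: ge0_le_integral => //.
  - by move=> x _; rewrite -EFinM lee_fin mulr_ge0 // ltW.
  - apply: measurable_funeM; apply/measurable_EFinP; exact: measurable_indic.
  - by apply/measurable_EFinP.
  - move=> x _; rewrite -EFinM lee_fin indicE.
    have [|] := boolP (x \in B); rewrite ?mulr1 ?mulr0 ?inE //.
    by move=> _; apply: sumr_ge0 => i _; rewrite mulr_ge0.
rewrite -[X in _ -> (X <= _)%E]mul1e -(mulVf (lt0r_neq0 t0)) EFinM -muleA EFinM.
by apply: lee_wpmul2l; rewrite lee_fin invr_ge0 ltW.
Qed.

End MeasureBounds.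

(** * Upper bound for the growth rate *)

Section Growth.
Local Open Scope classical_set_scope.
Variables (R : realType) (beta : R) (m : nat).
Hypothesis beta1 : 1 < beta.

Local Notation width := ((m%:R - 1) / (beta - 1)).

Lemma digit_tail_bound (e : nat -> 'I_m) j :
  0 <= \sum_(k < j) (e k : nat)%:R * beta ^- k.+1 <= width.
Proof.
have b0 : 0 < beta by apply: lt_trans beta1.
apply/andP; split.
  by apply: sumr_ge0 => k _; rewrite mulr_ge0 // invr_ge0 exprn_ge0 // ltW.
have m0 : (0 < m)%N by case: m e => // e; case: (e 0%N).
have M0 : 0 <= m%:R - 1 :> R by rewrite subr_ge0 ler1n.
apply: (@le_trans _ _ (\sum_(k < j) (m%:R - 1) * beta ^- k.+1)).
  apply: ler_sum => k _; rewrite ler_wpM2r ?invr_ge0 ?exprn_ge0 ?(ltW b0) //.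
  by rewrite lerBrDr natr1 ler_nat ltn_ord.
rewrite -mulr_sumr ler_wpM2l //.
have -> : \sum_(k < j) beta ^- k.+1 = beta^-1 * \sum_(k < j) (beta^-1) ^+ k :> R.
  by rewrite mulr_sumr; apply: eq_bigr => k _; rewrite -exprVn exprS.
apply: (@le_trans _ _ (beta^-1 * (1 - beta^-1)^-1)).
  rewrite ler_wpM2l ?invr_ge0 ?(ltW b0) // geom_sum_le // invr_ge0 ltW //=.
  by rewrite invf_lt1.
by rewrite -invfM mulrBr mulfV ?lt0r_neq0 // mulr1.
Qed.

Lemma expansion_prefix_bound n (w : n.-tuple 'I_m) (e : nat -> 'I_m) x :
  (forall k : 'I_n, e k = tnth w k) -> is_expansion beta x e ->
  beta ^- n * word_value beta w <= x <= beta ^- n * (word_value beta w + width).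
Proof.
move=> ew ex; have bn : 0 <= beta ^- n.
  by rewrite invr_ge0 exprn_ge0 // ltW // (lt_trans ltr01).
have tail N : (n <= N)%N ->
  beta ^- n * word_value beta w <=
    series (fun k => (e k : nat)%:R * beta ^- k.+1) N <=
  beta ^- n * (word_value beta w + width).
  move=> nN; rewrite -(subnKC nN) (series_prefix beta1 _ ew) !ler_wpM2l //.
    by rewrite lerD2l; have /andP[] := digit_tail_bound (fun k => e (n + k)%N) (N - n).
  by rewrite lerDl; have /andP[] := digit_tail_bound (fun k => e (n + k)%N) (N - n).
apply/andP; split.
  by apply: (cvgr_to_ge ex); exists n => // N /= /tail /andP[].
by apply: (cvgr_to_le ex); exists n => // N /= /tail /andP[].
Qed.

Lemma expansion_wordsP n (w : n.-tuple 'I_m) x :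
  reflect (exists e : nat -> 'I_m,
    (forall k : 'I_n, e k = tnth w k) /\ is_expansion beta x e)
  (w \in expansion_words m beta n x).
Proof. by rewrite finset.in_set; apply: asboolP. Qed.

(** Any tail that completes w also completes u. *)
Lemma expansion_words_saturated n (w u : n.-tuple 'I_m) x :
  word_value beta u = word_value beta w ->
  w \in expansion_words m beta n x -> u \in expansion_words m beta n x.
Proof.
move=> uw /expansion_wordsP[e [ew ex]]; apply/expansion_wordsP.
(* The digits of u, followed by those of the expansion beginning with w. *)
pose e' k := if insub k is Some i then tnth u (i : 'I_n) else e k.
have e'u (k : 'I_n) : e' k = tnth u k by rewrite /e' valK.
exists e'; split; first exact: e'u.
rewrite /is_expansion -(cvg_shiftn n).
have {}ex := ex; rewrite /is_expansion -(cvg_shiftn n) in ex; move: ex.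
set f := (X in X @ _ --> _ -> _); set g := (X in _ -> X @ _ --> _).
suff -> : g = f by [].
apply/funext => j; rewrite /f /g /= addnC.
rewrite (series_prefix beta1 _ ew) (series_prefix beta1 _ e'u) uw.
congr (_ * (_ + _)); apply: eq_bigr => k _; congr (_%:R * _).
by rewrite /e' insubN // -leqNgt leq_addr.
Qed.

(** With N the number of words that begin an expansion of x, write the square
    root of N as N copies of its N-th part. By [expansion_words_saturated] the
    multiplicity of each of these words is at most N. *)
Lemma sqrt_count_le n x :
  Num.sqrt (expansion_count m beta n x)%:R <=
  \sum_(w : n.-tuple 'I_m) (Num.sqrt (multiplicity beta w)%:R)^-1 *
     \1_(`[beta ^- n * word_value beta w,
           beta ^- n * word_value beta w + beta ^- n * width]%classic) x :> R.
Proof.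
set N := expansion_count m beta n x.
have [->|N0] := posnP N.
  rewrite sqrtr0; apply: sumr_ge0 => w _; apply: mulr_ge0; last by rewrite indicE.
  by rewrite invr_ge0 sqrtr_ge0.
have sN : 0 < Num.sqrt N%:R :> R by rewrite sqrtr_gt0 ltr0n.
have -> : Num.sqrt N%:R =
    \sum_(w in expansion_words m beta n x) (Num.sqrt N%:R)^-1 :> R.
  rewrite sumr_const -/(expansion_count _ _ _ _) -/N -[RHS]mulr_natl.
  by rewrite -{2}(sqr_sqrtr (ler0n R N)) expr2 mulfK // gt_eqF.
rewrite big_mkcond /=; apply: ler_sum => w _; case: ifPn => [wE|_]; last first.
  by rewrite mulr_ge0 // ?indicE // invr_ge0 sqrtr_ge0.
have : x \in (`[beta ^- n * word_value beta w,
           beta ^- n * word_value beta w + beta ^- n * width]%classic : set R).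
  have /expansion_wordsP[e [ew ex]] := wE; rewrite inE /=.
  by rewrite in_itv /= -mulrDr; exact: expansion_prefix_bound ex.
rewrite indicE => ->; rewrite mulr1 lef_pV2 ?posrE //; last first.
  by rewrite sqrtr_gt0 ltr0n multiplicity_gt0.
rewrite ler_wsqrtr // ler_nat; apply/subset_leq_card/fintype.subsetP => u.
by rewrite inE => /eqP uw; apply: expansion_words_saturated uw wE.
Qed.

(** If gamma were larger, then for almost every x the step functions of
    [sqrt_count_le] would eventually exceed at length j K thresholds that grow
    faster than Theta^j / beta^(jK), while by Markov's inequality the sets where
    they do so have geometrically decreasing measure. *)
Lemma growth_rate_upper_bound (gamma C Theta : R) (K : nat) :
  beta < m%:R -> 0 < gamma -> is_growth_rate beta m gamma ->
  (0 < K)%N -> 0 < Theta ->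
  (forall j, affinity beta m (j * K) <= C * Theta ^+ j) ->
  K%:R * gamma <= 2 * ln (Theta / beta ^+ K).
Proof.
move=> bm gamma0 gammaP K0 Theta0 aff; rewrite leNgt; apply/negP => lt_rate.
have b0 : 0 < beta by apply: lt_trans beta1.
have KR : 0 < K%:R :> R by rewrite ltr0n.
have bK : 0 < beta ^+ K by rewrite exprn_gt0.
have w0 : 0 < width.
  by rewrite divr_gt0 // subr_gt0 // (lt_trans beta1).
(* The maximum with 0 keeps g positive, so that a count equal to 0, whose
   logarithm is 0 by convention, is excluded below. *)
pose l := Num.max 0 (2 * ln (Theta / beta ^+ K) / K%:R).
have lg : l < gamma by rewrite /l gt_max gamma0 ltr_pdivrMr // [gamma * _]mulrC.
pose g := (l + gamma) / 2.
have l0 : 0 <= l by rewrite /l le_max lexx.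
have lK : 2 * ln (Theta / beta ^+ K) <= l * K%:R.
  by rewrite -ler_pdivrMr // /l le_max lexx orbT.
have g0 : 0 < g by rewrite /g; lra.
have gg : g < gamma by rewrite /g; lra.
(* The division by 2 accounts for the square root of the count. *)
pose E := expR (K%:R * g / 2).
have E0 : 0 < E by exact: expR_gt0.
have TE : Theta / beta ^+ K < E.
  rewrite -[ltLHS]lnK ?posrE ?divr_gt0 // ltr_expR ltr_pdivlMr // mulrC.
  by apply: le_lt_trans lK _; rewrite mulrC ltr_pM2l // /g; lra.
pose r := Theta / beta ^+ K / E.
have r0 : 0 <= r by rewrite /r !divr_ge0 // ltW.
have r1 : `|r| < 1 by rewrite ger0_norm // ltr_pdivrMr // mul1r.
pose a j (w : (j * K).-tuple 'I_m) := (Num.sqrt (multiplicity beta w)%:R)^-1 : R.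
pose lo j (w : (j * K).-tuple 'I_m) := beta ^- (j * K) * word_value beta w.
pose len j := beta ^- (j * K) * width.
pose B j := [set x : R | E ^+ j <=
  \sum_w a j w * \1_(`[lo j w, lo j w + len j]%classic) x].
have HB j : measurable (B j) /\ (lebesgue_measure (B j) <=
    ((E ^+ j)^-1 * \sum_w a j w * len j)%:E)%E.
  apply: (@lebesgue_superlevel_step R _ (a j) (lo j) (fun=> len j)).
  - by rewrite exprn_gt0.
  - by move=> w; rewrite invr_ge0 sqrtr_ge0.
  - by move=> w; rewrite mulr_ge0 ?invr_ge0 ?exprn_ge0 // ltW.
have negA : lebesgue_measure.-negligible
  [set x : R | expansion_interval m beta x /\
    (fun n => n%:R^-1 * ln (expansion_count m beta n x)%:R) @ \oo --> gamma].
  apply: (@negligible_of_small_cover R _ (C * width) r B r1) => [j|j|x [Ix]].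
  - by have [] := HB j.
  - have [_ /le_trans] := HB j; apply; rewrite lee_fin -mulr_suml.
    rewrite [X in X * len j](_ : _ = affinity beta m (j * K)) //.
    rewrite /r !exprMn !exprVn /len.
    have -> : beta ^- (j * K) = (beta ^+ K) ^- j by rewrite mulnC exprM.
    set e := _ ^- j * width; set e' := (E ^+ j)^-1.
    have -> : C * width * (Theta ^+ j / (beta ^+ K) ^+ j * e') =
      e' * (C * Theta ^+ j * e) by rewrite /e; ring.
    rewrite ler_wpM2l ?invr_ge0 ?exprn_ge0 ?(ltW E0) // ler_wpM2r //.
    by rewrite mulr_ge0 ?invr_ge0 ?exprn_ge0 // ltW.
  - move=> /cvgr_gt /(_ _ gg)[n0 _ Hn0].
    exists n0.+1 => // j /= jn0.
    have jK0 : (0 < j * K)%N by rewrite muln_gt0 K0 andbT (leq_trans _ jn0).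
    have := Hn0 (j * K)%N (leq_trans (ltnW jn0) (leq_pmulr _ K0)).
    rewrite /= mulrC ltr_pdivlMr ?ltr0n // => gN.
    apply: le_trans (sqrt_count_le (j * K) x).
    set N := expansion_count _ _ _ _ in gN *.
    have N0 : (0 < N)%N.
      case: N gN => // ; rewrite ln0 // => h.
      by move: h; rewrite ltNge mulr_ge0 // ltW.
    rewrite -(@ler_pXn2r _ 2) ?nnegrE ?sqrtr_ge0 ?exprn_ge0 ?(ltW E0) //.
    rewrite sqr_sqrtr // -[leRHS]lnK ?posrE ?ltr0n // -exprM -expRM_natl.
    rewrite ler_expR; apply: le_trans (ltW gN).
    rewrite le_eqVlt; apply/orP; left; apply/eqP.
    by rewrite !natrM; field.
(* The interval would be covered by two negligible sets. *)
have negI : lebesgue_measure.-negligible (expansion_interval m beta).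
  apply: negligibleS (negligibleU negA gammaP) => x Ix /=.
  have [cx|ncx] := pselect ((fun n => n%:R^-1 *
    ln (expansion_count m beta n x)%:R) @ \oo --> gamma); [left|right] => //.
  by move=> /(_ Ix).
move/negligibleP : negI => /(_ (measurable_itv _)).
rewrite /expansion_interval [LHS]lebesgue_measure_itv /= lte_fin w0 -EFinB subr0.
by move=> [] w00; move: w0; rewrite w00 ltxx.
Qed.

End Growth.

(** * Lower bound in integer bases *)

Section RadixExpansion.
Local Open Scope classical_set_scope.
Variables (R : realType) (b : nat).
Hypothesis b1 : (1 < b)%N.

(** The digit of rank k, counted from 0, after the point of a nonnegative y in
    base b. *)
Definition radix_digit (y : R) k : nat :=
  (Num.truncn (b%:R ^+ k.+1 * y) - b * Num.truncn (b%:R ^+ k * y))%N.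

Lemma truncn_radix (y : R) k : 0 <= y ->
  (b * Num.truncn (b%:R ^+ k * y) <= Num.truncn (b%:R ^+ k.+1 * y)
    < b * Num.truncn (b%:R ^+ k * y) + b)%N.
Proof.
move=> y0; have h k' : 0 <= b%:R ^+ k' * y by rewrite mulr_ge0 // exprn_ge0.
have /andP[lo hi] := truncn_itv (h k); have /andP[lo' hi'] := truncn_itv (h k.+1).
have bR : 0 < b%:R :> R by rewrite ltr0n (ltn_trans _ b1).
apply/andP; split.
  rewrite -ltnS -(ltr_nat R); apply: le_lt_trans hi'.
  by rewrite natrM exprS -mulrA ler_pM2l.
rewrite -(ltr_nat R); apply: le_lt_trans lo' _.
rewrite -mulnSr natrM exprS -mulrA ltr_pM2l //.
Qed.

Lemma radix_digit_lt (y : R) k : 0 <= y -> (radix_digit y k < b)%N.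
Proof. by move=> /(truncn_radix k); rewrite /radix_digit; lia. Qed.

Lemma radix_partial_sum (y : R) n : 0 <= y < 1 ->
  \sum_(k < n) (radix_digit y k)%:R * b%:R ^- k.+1 =
  (Num.truncn (b%:R ^+ n * y))%:R / b%:R ^+ n :> R.
Proof.
move=> /andP[y0 y1]; have bR : b%:R != 0 :> R by rewrite pnatr_eq0; lia.
elim: n => [|n IH].
  by rewrite big_ord0 expr0 mul1r (@truncn_def _ y 0) ?y0 // mul0r.
rewrite big_ord_recr /= IH /radix_digit natrB; last first.
  by have /andP[] := truncn_radix n y0.
rewrite natrM mulrBl addrCA [X in _ + X](_ : _ = 0) ?addr0 // exprS.
by field; rewrite bR expf_neq0.
Qed.

Lemma radix_expansion_cvg (y : R) : 0 <= y < 1 ->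
  (fun n => \sum_(k < n) (radix_digit y k)%:R * b%:R ^- k.+1 : R) @ \oo --> y.
Proof.
move=> y01; have /andP[y0 _] := y01.
have bR : 0 < b%:R :> R by rewrite ltr0n; lia.
have := @cvg_expr R (b%:R^-1) _; rewrite ger0_norm ?invr_ge0 ?ltW //.
rewrite invf_lt1 // ltr1n => /(_ b1) c.
apply: (@squeeze_cvgr _ _ _ _ (fun n => y - b%:R^-1 ^+ n) (fun=> y)).
- near=> n; rewrite radix_partial_sum //.
  have h : 0 <= b%:R ^+ n * y by rewrite mulr_ge0 // exprn_ge0.
  have /andP[lo hi] := truncn_itv h.
  rewrite exprVn ler_pdivrMr ?exprn_gt0 // [y * _]mulrC lo andbT.
  rewrite ler_pdivlMr ?exprn_gt0 // mulrBl mulVf ?expf_neq0 ?gt_eqF //.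
  by rewrite lerBlDr mulrC natr1 ltW.
- by rewrite -[X in _ --> X]subr0; apply: cvgB => //; apply: cvg_cst.
- exact: cvg_cst.
Unshelve. all: by end_near. Qed.

End RadixExpansion.

Section IntegerBase.
Local Open Scope classical_set_scope.

(** After j zeros, let e_1, ..., e_n be arbitrary digits smaller than q. For j
    large enough depending on x, the digits b e_k represent together at most x,
    and the radix-b digits d_k of the difference complete them: the word of the
    digits d_k + b e_k begins an expansion of x, and division by b recovers the
    e_k from it. *)
Lemma radix_count_lower_bound (R : realType) (b q : nat) (x : R) :
  (1 < b)%N -> (0 < q)%N -> 0 < x < 1 ->
  exists j : nat, forall n,
    (q ^ n <= expansion_count (b * q) (b%:R : R) (j + n) x)%N.
Proof.
move=> b1 q0 /andP[x0 x1].
have bR : 0 < b%:R :> R by rewrite ltr0n; lia.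
have bR1 : 1 < b%:R :> R by rewrite ltr1n.
have bb : (b%:R : R)^-1 < 1 by rewrite invf_lt1.
have [j Hj] : exists j, b%:R * b%:R ^- j * ((q%:R - 1) / (b%:R - 1)) <= x.
  have := @cvg_expr R (b%:R^-1) _; rewrite ger0_norm ?invr_ge0 ?ltW // => /(_ bb).
  move=> /(cvgM (cvg_cst (b%:R * ((q%:R - 1) / (b%:R - 1)) : R))).
  rewrite mulr0 => /cvgrPdist_le /(_ _ x0)[j _ /(_ j (leqnn _))].
  rewrite sub0r normrN => h; exists j; apply: le_trans h.
  by rewrite -exprVn mulrAC; apply: ler_norm.
exists j => n.
(* The default value 0 of nth also fills the ranks after j + n. *)
pose F (f : n.-tuple 'I_q) k : nat :=
  if (k < j)%N then 0%N else nth 0%N (map val f) (k - j).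
have Fq f k : (F f k < q)%N.
  rewrite /F; case: ifP => // _; have [h|h] := ltnP (k - j) n.
    by rewrite (nth_map (Ordinal q0)) ?size_tuple //; apply: ltn_ord.
  by rewrite nth_default // size_map size_tuple.
pose e0 f k := Ordinal (Fq f k).
pose s f : R := \sum_(k < j + n) (F f k)%:R * b%:R ^- k.
have s0 f : 0 <= s f.
  by apply: sumr_ge0 => k _; rewrite mulr_ge0 // invr_ge0 exprn_ge0 // ltW.
have sx f : s f <= x.
  apply: le_trans Hj.
  rewrite /s big_split_ord /= big1 ?add0r; last first.
    by case=> k kj _; rewrite /F /= kj mul0r.
  have /andP[_] := digit_tail_bound bR1 (fun k => e0 f (j + k)%N) n.
  move=> /(ler_wpM2l (_ : 0 <= b%:R * b%:R ^- j)) h; apply: le_trans (h _).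
    rewrite mulr_sumr; apply: ler_sum => k _ /=.
    have E : b%:R * b%:R ^- j * b%:R ^- k.+1 = b%:R ^- (j + k) :> R.
      by rewrite exprS exprD; field; rewrite !expf_neq0 ?gt_eqF.
    by rewrite mulrCA E.
  by rewrite mulr_ge0 ?invr_ge0 ?exprn_ge0 // ltW.
have y01 f : 0 <= x - s f < 1.
  by rewrite subr_ge0 sx /=; apply: le_lt_trans x1; rewrite gerBl.
pose D f k := radix_digit b (x - s f) k.
have Db f k : (D f k < b)%N.
  by apply: radix_digit_lt => //; have /andP[] := y01 f.
have Wm f k : (D f k + b * F f k < b * q)%N.
  have := Fq f k; have := Db f k; move: (D f k) (F f k) => d u.
  move=> db uq; apply: (@leq_trans (b * u.+1)); first by rewrite mulnS; lia.
  by rewrite leq_mul2l uq orbT.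
pose e f k := Ordinal (Wm f k).
pose W f : (j + n).-tuple 'I_(b * q) := [tuple e f k | k < j + n].
have Winj : injective W.
  move=> f g fg; apply: eq_from_tnth => i.
  have := congr1 (fun w => val (tnth w (rshift j i))) fg.
  rewrite /= !tnth_mktuple /= => E.
  have := congr1 (fun w => w %/ b)%N E.
  rewrite ![(D _ _ + _)%N]addnC ![(b * _)%N]mulnC !divnMDl ?(ltn_trans _ b1) //.
  rewrite !divn_small // !addn0 /F /= ltnNge leq_addr /= addKn => {E}E.
  apply: val_inj; rewrite !(tnth_nth (Ordinal q0)).
  by move: E; rewrite !(nth_map (Ordinal q0)) ?size_tuple.
rewrite -[q in (q ^ n)%N]card_ord -card_tuple -(card_imset _ Winj).
apply/subset_leq_card/fintype.subsetP => _ /imsetP[f _ ->].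
apply/expansion_wordsP; exists (e f); split.
  by move=> k; rewrite tnth_mktuple.
rewrite /is_expansion -(cvg_shiftn (j + n)).
have cD := radix_expansion_cvg b1 (y01 f).
have cu := cvgD cD (cvg_cst (s f)); rewrite subrK -(cvg_shiftn (j + n)) in cu.
erewrite eq_cvg; first exact: cu.
move=> k /=.
rewrite /series /= big_mkord.
rewrite [(k + _)%N]addnC.
have sE : s f = \sum_(i < j + n + k) (F f i)%:R * b%:R ^- i.
  rewrite [RHS]big_split_ord /= [X in _ + X]big1 ?addr0 // => i _.
  rewrite /F ltnNge -addnA leq_addr /= addKn nth_default ?mul0r //.
  by rewrite size_map size_tuple leq_addr.
transitivity (\sum_(i < j + n + k) (D f i)%:R * b%:R ^- i.+1 + s f); last by [].
rewrite sE -big_split /=; apply: eq_bigr => i _.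
rewrite natrD mulrDl natrM exprS invfM; congr (_ + _).
by rewrite mulrACA mulfV ?mul1r // gt_eqF.
Qed.

(** The almost everywhere limit is attained at some x of the open unit
    interval, where the lower bound on the count applies. *)
Lemma integer_base_growth_rate (R : realType) (b q : nat) (gamma : R) :
  (1 < b)%N -> (0 < q)%N -> is_growth_rate (b%:R : R) (b * q) gamma ->
  ln q%:R <= gamma.
Proof.
move=> b1 q0 gammaP; rewrite leNgt; apply/negP => lt_rate.
have [x [x01 cx]] : exists x : R, 0 < x < 1 /\
    (fun n => n%:R^-1 * ln (expansion_count (b * q) (b%:R : R) n x)%:R) @ \oo
      --> gamma.
  apply: contrapT => nex.
  have : lebesgue_measure.-negligible (`]0, 1[%classic : set R).
    apply: negligibleS gammaP => x /= /[!in_itv] /= x01 /(_ _) cx.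
    apply: nex; exists x; split=> //; apply: cx.
    have b1R : 0 < b%:R - 1 :> R by rewrite subr_gt0 ltr1n.
    rewrite /expansion_interval /= in_itv /=; case/andP: x01 => /ltW -> x1 /=.
    apply: le_trans (ltW x1) _; rewrite ler_pdivlMr // mul1r lerD2r ler_nat.
    exact: leq_pmulr.
  move/negligibleP => /(_ (measurable_itv _)).
  rewrite [LHS]lebesgue_measure_itv /= lte_fin ltr01 -EFinB subr0.
  by move=> [] /eqP; rewrite oner_eq0.
have [j Hj] := radix_count_lower_bound b1 q0 x01.
pose g := (gamma + ln q%:R) / 2.
have [gg gq] : gamma < g /\ g < ln q%:R by rewrite /g; split; lra.
have [n0 _ Hn] := cvgr_lt _ cx _ gg.
have q0R : 0 < q%:R :> R by rewrite ltr0n.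
have lnq n : (n%:R : R) * ln q%:R = ln ((q ^ n)%N%:R).
  by rewrite natrX lnXn // mulr_natl.
pose n := (n0 + (Num.truncn (j%:R * g / (ln q%:R - g))).+1)%N.
have := Hn (j + n)%N; rewrite /= => /(_ _).
have jn : (0 < j + n)%N by rewrite /n; lia.
rewrite mulrC ltr_pdivrMr ?ltr0n // => h.
have {}h : ln (expansion_count (b * q) (b%:R : R) (j + n) x)%:R < g * (j + n)%:R.
  by apply: h; rewrite /n; lia.
have : (n%:R : R) * ln q%:R < g * (j + n)%:R.
  apply: le_lt_trans h; rewrite lnq ler_ln ?posrE ?ltr0n ?expn_gt0 ?q0 //.
    by rewrite ler_nat.
  by apply: leq_trans (Hj n); rewrite expn_gt0 q0.
rewrite natrD mulrDr -ltrBlDr [n%:R * _]mulrC -mulrBl.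
apply/negP; rewrite -leNgt.
have qg : 0 < ln q%:R - g by rewrite subr_gt0.
have := truncnS_gt (j%:R * g / (ln q%:R - g)); rewrite ltr_pdivrMr // => /ltW hh.
rewrite [g * _]mulrC; apply: le_trans hh _.
by rewrite mulrC ler_wpM2l ?(ltW qg) // ler_nat /n leq_addl.
Qed.

End IntegerBase.

(** * Characters of the circle *)

Section CircleExponential.
Variable R : realType.
Implicit Types s t : R.

Lemma abs_sin_le t : `|sin t| <= `|t|.
Proof.
have pos (x : R) : 0 < x -> `|sin x| <= x.
  move=> x0; have c0 : {within `[0, x], continuous (@sin R)}%classic.
    by apply: continuous_subspaceT => y; apply: continuous_sin.
  have [c _] := MVT x0 (fun y _ => is_derive_sin y) c0.
  rewrite sin0 !subr0 => ->; rewrite normrM (ger0_norm (ltW x0)).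
  by rewrite ler_piMl ?(ltW x0) // cos_max.
have [->|t0] := eqVneq t 0; first by rewrite sin0 normr0.
have [h|h] := ltP 0 t; first by rewrite (gtr0_norm h); exact: pos.
have t_lt0 : t < 0 by rewrite lt_neqAle t0.
by rewrite (ltr0_norm t_lt0) -normrN -sinN; apply: pos; rewrite oppr_gt0.
Qed.

(** The character exp (2 i pi t) of the circle. *)
Definition cexp t : R[i] := (cos (2 * pi * t) +i* sin (2 * pi * t))%C.

Lemma cexp0 : cexp 0 = 1.
Proof. by rewrite /cexp mulr0 cos0 sin0. Qed.

Lemma cexpD s t : cexp (s + t) = cexp s * cexp t.
Proof. by rewrite /cexp mulrDr cosD sinD; simpc; congr (_ +i* _)%C; ring. Qed.

Lemma cexpN t : cexp (- t) = ((cexp t)^*)%C.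
Proof. by rewrite /cexp mulrN cosN sinN. Qed.

Lemma cexp1 : cexp 1 = 1.
Proof. by rewrite /cexp mulr1 mulrC mulr_natr cos2pi sin2pi. Qed.

Lemma cexp_nat (n : nat) : cexp n%:R = 1.
Proof. by elim: n => [|n IH]; rewrite ?cexp0 // -natr1 cexpD IH cexp1 mulr1. Qed.

Lemma cexp_int (k : int) : cexp k%:~R = 1.
Proof.
by case: k => n; [exact: cexp_nat | rewrite NegzE mulrNz cexpN cexp_nat conjc1].
Qed.

Lemma cexpM (n : nat) t : cexp (n%:R * t) = cexp t ^+ n.
Proof.
elim: n => [|n IH]; first by rewrite mul0r cexp0.
by rewrite -natr1 mulrDl mul1r cexpD IH exprSr.
Qed.

Lemma cexp_sum I (r : seq I) (P : pred I) (F : I -> R) :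
  cexp (\sum_(i <- r | P i) F i) = \prod_(i <- r | P i) cexp (F i).
Proof. exact: (big_morph _ cexpD cexp0). Qed.

Lemma cnorm_cexp t : cnorm (cexp t) = 1.
Proof. by rewrite /cnorm /cexp /= cos2Dsin2 sqrtr1. Qed.

Lemma cnorm_cexpB1 t : cnorm (cexp t - 1) = 2 * `|sin (pi * t)|.
Proof.
rewrite /cnorm /cexp /= subr0.
have -> : 2 * pi * t = (pi * t) *+ 2 by rewrite mulr2n; ring.
rewrite cos_mulr2n sin_mulr2n cos2sin2.
set c := cos _; set s := sin _.
have -> : ((1 - s ^+ 2) *+ 2 - 1 - 1) ^+ 2 + ((c * s) *+ 2) ^+ 2 = (2 * s) ^+ 2.
  have -> : (c * s) *+ 2 = 2 * (c * s) by rewrite mulr_natl.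
  by rewrite !exprMn /c cos2sin2 -/s mulr2n; ring.
by rewrite sqrtr_sqr normrM ger0_norm.
Qed.

Lemma cexp_lipschitz s t : cnorm (cexp s - cexp t) <= 2 * pi * `|s - t|.
Proof.
have -> : cexp s - cexp t = cexp t * (cexp (s - t) - 1).
  by rewrite mulrBr mulr1 -cexpD [t + _]addrC subrK.
rewrite cnormM cnorm_cexp mul1r cnorm_cexpB1 -mulrA ler_wpM2l //.
by apply: le_trans (abs_sin_le _) _; rewrite normrM (ger0_norm (pi_ge0 R)).
Qed.

Lemma cexp_neq1 t : 0 < `|t| < 1 -> cexp t != 1.
Proof.
move=> /andP[t0 t1]; apply/eqP => E; have := cnorm_cexpB1 t.
rewrite E subrr cnorm0 => /esym/eqP; rewrite mulf_eq0 pnatr_eq0 /= normr_eq0.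
have sp (x : R) : 0 < x < 1 -> sin (pi * x) != 0.
  move=> /andP[x0 x1]; rewrite gt_eqF // sin_gt0_pi // mulr_gt0 ?pi_gt0 //=.
  by rewrite gtr_pMr ?pi_gt0.
have [h|h] := ger0P t; first by apply/negP/sp; rewrite -(ger0_norm h) t0.
by rewrite -oppr_eq0 -sinN -mulrN; apply/negP/sp; rewrite -(ltr0_norm h) t0.
Qed.

Lemma cexp_eq1 t : cexp t = 1 -> exists k : int, t = k%:~R.
Proof.
move=> E; exists (Num.floor t); apply/eqP; rewrite -subr_eq0; apply/negPn/negP => f0.
have /andP[lo hi] := floor_itv t.
have : cexp (t - (Num.floor t)%:~R) != 1.
  apply: cexp_neq1; rewrite normr_gt0 f0 /= ger0_norm ?subr_ge0 //.
  by rewrite ltrBlDr addrC -intrD1.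
by rewrite cexpD cexpN cexp_int conjc1 mulr1 E eqxx.
Qed.

Lemma geometric_cexp_bound t n : cexp t != 1 ->
  cnorm (\sum_(i < n) cexp (t * i%:R)) <= 2 / cnorm (cexp t - 1).
Proof.
move=> t1.
have n0 : 0 < cnorm (cexp t - 1).
  rewrite lt_neqAle cnorm_ge0 andbT eq_sym; apply: contra_neq t1 => h.
  apply/eqP; rewrite -subr_eq0; apply/eqP.
  by apply: ComplexField.Normc.eq0_normc.
rewrite ler_pdivlMr // -cnormM mulrC.
have -> : \sum_(i < n) cexp (t * i%:R) = \sum_(i < n) cexp t ^+ i.
  by apply: eq_bigr => i _; rewrite mulrC cexpM.
rewrite -subrX1; apply: le_trans (cnormB _ _) _.
by rewrite cnorm1 cnormX cnorm_cexp expr1n.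
Qed.

End CircleExponential.

(** * Fourier transform of the uniform law on words *)

Section DigitTransform.
Variables (R : realType) (m : nat).
Hypothesis m0 : (0 < m)%N.
Implicit Types s t x y : R.

(** The Fourier transform of the uniform law on the digits. *)
Definition digit_transform t : R[i] :=
  m%:R^-1 * \sum_(d < m) cexp ((d : nat)%:R * t).
Local Notation phi := digit_transform.

Let mC : (m%:R : R[i]) != 0.
Proof. by rewrite pnatr_eq0 -lt0n. Qed.

Lemma digit_mean_dist_le (F G : 'I_m -> R[i]) (B : R) :
  (forall d, cnorm (F d - G d) <= B) ->
  cnorm (m%:R^-1 * (\sum_d F d) - m%:R^-1 * \sum_d G d) <= B.
Proof.
move=> FG; rewrite -mulrBr cnormM cnorm_natV ler_pdivrMl ?ltr0n //.
rewrite -sumrB; apply: le_trans (cnorm_sum _ _ _) _.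
rewrite -[m in m%:R]card_ord mulr_natl -sumr_const; exact: ler_sum.
Qed.

Lemma digit_transform_le1 t : cnorm (phi t) <= 1.
Proof.
have := @digit_mean_dist_le (fun d => cexp (d%:R * t)) (fun=> 0) 1.
rewrite sumr_const mul0rn mulr0 subr0; apply => d.
by rewrite subr0 cnorm_cexp.
Qed.

Lemma digit_transform_lipschitz s t :
  cnorm (phi s - phi t) <= 2 * pi * m%:R * `|s - t|.
Proof.
apply: digit_mean_dist_le => d; apply: le_trans (cexp_lipschitz _ _) _.
rewrite -mulrBr normrM normr_nat mulrA; apply: ler_wpM2r => //.
by apply: ler_wpM2l; rewrite ?mulr_ge0 ?pi_ge0 // ler_nat ltnW.
Qed.

Lemma digit_transformDint t (k : int) : phi (t + k%:~R) = phi t.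
Proof.
congr (_ * _); apply: eq_bigr => d _.
have E : (d : nat)%:R * k%:~R = (Posz d * k)%:~R :> R by rewrite intrM.
by rewrite mulrDr cexpD E cexp_int mulr1.
Qed.

Lemma digit_transform_int (k : int) : phi k%:~R = 1.
Proof.
rewrite -[k%:~R]add0r digit_transformDint /phi.
rewrite (eq_bigr (fun=> 1)) => [|d _]; last by rewrite mulr0 cexp0.
by rewrite sumr_const card_ord mulVf.
Qed.

Lemma digit_transformN t : phi (- t) = ((phi t)^*)%C.
Proof.
rewrite /phi rmorphM rmorph_sum fmorphV rmorph_nat; congr (_ * _).
by apply: eq_bigr => d _; rewrite mulrN cexpN.
Qed.

Lemma digit_transform_near_int t (k : int) :
  1 - 2 * pi * m%:R * `|t - k%:~R| <= cnorm (phi t).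
Proof.
have h := digit_transform_lipschitz t k%:~R; rewrite digit_transform_int in h.
rewrite lerBlDl -lerBlDr; apply: le_trans h.
rewrite lerBlDr -[X in X <= _](@cnorm1 R).
rewrite -[X in cnorm X <= _](subrK (phi t)) cnorm_distC; exact: cnormD.
Qed.

(** When x is near an integer, phi (x - y) is near phi (- y) and phi x is near
    1, so phi is nearly multiplicative. *)
Lemma digit_transform_cov x y (k : int) :
  cnorm (phi (x - y) - phi x * ((phi y)^*)%C) <= 4 * pi * m%:R * `|x - k%:~R|.
Proof.
rewrite -digit_transformN.
have -> : phi (x - y) - phi x * phi (- y) =
    (phi (x - y) - phi (k%:~R - y)) + (phi k%:~R - phi x) * phi (- y).
  rewrite mulrBl digit_transform_int mul1r.
  by rewrite [k%:~R - y]addrC digit_transformDint addrA subrK.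
apply: le_trans (cnormD _ _) _; rewrite cnormM.
have h1 := digit_transform_lipschitz (x - y) (k%:~R - y).
have h2 := digit_transform_lipschitz k%:~R x.
have h3 := digit_transform_le1 (- y).
have E1 : x - y - (k%:~R - y) = x - k%:~R by ring.
rewrite E1 in h1; rewrite distrC in h2.
have h4 := ler_piMr (cnorm_ge0 (phi k%:~R - phi x)) h3.
apply: le_trans (lerD h1 (le_trans h4 h2)) _.
by rewrite le_eqVlt; apply/orP; left; apply/eqP; ring.
Qed.

(** A vanishing sum of a geometric progression of ratio exp (2 i pi t) and
    length m means that the ratio is an m-th root of unity other than 1. *)
Lemma digit_transform_eq0 t : phi t = 0 ->
  (exists k : int, m%:R * t = k%:~R) /\ ~ (exists k : int, t = k%:~R).
Proof.
move=> p0; split; last first.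
  by move=> [k tk]; move/eqP: p0; rewrite tk digit_transform_int oner_eq0.
apply: cexp_eq1; apply/eqP; rewrite cexpM -subr_eq0 subrX1.
rewrite (_ : \sum_(i < m) _ = 0) ?mulr0 //.
have := congr1 (fun z => m%:R * z) p0; rewrite /phi mulVKf // mulr0 => E.
rewrite -[RHS]E.
by apply: eq_bigr => d _; rewrite cexpM.
Qed.

Lemma sum_tuple_prod (A : comPzRingType) n (F : 'I_n -> 'I_m -> A) :
  \sum_(w : n.-tuple 'I_m) \prod_(i < n) F i (tnth w i) =
  \prod_(i < n) \sum_(d < m) F i d.
Proof.
rewrite bigA_distr_bigA /=.
pose h (f : {ffun 'I_n -> 'I_m}) : n.-tuple 'I_m := [tuple f i | i < n].
have hb : bijective h.
  exists (fun w => [ffun i => tnth w i]) => [f|w].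
    by apply/ffunP => i; rewrite ffunE tnth_mktuple.
  by apply: eq_from_tnth => i; rewrite tnth_mktuple ffunE.
rewrite (reindex h) /=; last exact: onW_bij.
by apply: eq_bigr => f _; apply: eq_bigr => i _; rewrite tnth_mktuple.
Qed.

(** The digits of a uniform word are independent. *)
Lemma word_value_transform (beta : R) n x :
  \sum_(w : n.-tuple 'I_m) cexp (x * word_value beta w) =
  m%:R ^+ n * \prod_(i < n) phi (beta ^+ i * x).
Proof.
transitivity (\sum_(w : n.-tuple 'I_m) \prod_(i < n)
    cexp ((tnth w i : nat)%:R * (beta ^+ (n - i.+1) * x))).
  apply: eq_bigr => w _; rewrite -cexp_sum mulr_sumr; congr cexp.
  by apply: eq_bigr => i _; ring.
rewrite (sum_tuple_prod (fun i d => cexp ((d : nat)%:R * (beta ^+ (n - i.+1) * x)))).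
rewrite (reindex_inj rev_ord_inj) /=.
rewrite -[X in m%:R ^+ X]card_ord -prodr_const -big_split /=.
apply: eq_bigr => i _; rewrite /phi mulVKf //.
by apply: eq_bigr => d _; congr (cexp (_ * (_ ^+ _ * _))); case: i => i /=; lia.
Qed.

End DigitTransform.

(** * Finite sums and products *)

Lemma sum_cauchy_schwarz (R : realType) (T : finType) (a b : T -> R) :
  \sum_i a i * b i <=
  Num.sqrt (\sum_i a i ^+ 2) * Num.sqrt (\sum_i b i ^+ 2).
Proof.
have A0 : 0 <= \sum_i a i ^+ 2 by apply: sumr_ge0 => i _; apply: sqr_ge0.
rewrite -sqrtrM //; apply: le_trans (ler_norm _) _; rewrite -sqrtr_sqr.
apply: ler_wsqrtr.
have : 0 <= \sum_i \sum_j (a i * b j - a j * b i) ^+ 2.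
  by apply: sumr_ge0 => i _; apply: sumr_ge0 => j _; apply: sqr_ge0.
have -> : \sum_i \sum_j (a i * b j - a j * b i) ^+ 2 =
  2 * ((\sum_i a i ^+ 2) * (\sum_i b i ^+ 2) - (\sum_i a i * b i) ^+ 2).
  rewrite mulrBr expr2 !big_distrlr /=.
  have -> : 2 * (\sum_i \sum_j a i ^+ 2 * b j ^+ 2) =
      \sum_i \sum_j a i ^+ 2 * b j ^+ 2 + \sum_i \sum_j a j ^+ 2 * b i ^+ 2 :> R.
    by rewrite [X in _ = _ + X]exchange_big /= mulr2n mulrDl !mul1r.
  rewrite mulr_sumr -big_split -sumrB /=; apply: eq_bigr => i _.
  rewrite mulr_sumr -big_split -sumrB /=; apply: eq_bigr => j _.
  by ring.
by rewrite pmulr_rge0 // subr_ge0.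
Qed.

Lemma prod_ge_1Bsum (R : realFieldType) (a : nat -> R) n :
  (forall i, 0 <= a i <= 1) ->
  1 - \sum_(i < n) (1 - a i) <= \prod_(i < n) a i.
Proof.
move=> a01; elim: n => [|n IH]; first by rewrite !big_ord0 subr0.
rewrite !big_ord_recr /=; have /andP[a0 a1] := a01 n.
have P1 : \prod_(i < n) a i <= 1.
  by apply: prodr_ile1 => i _; apply: a01.
move: IH P1; set s := \sum_(i < n) _; set p := \prod_(i < n) _ => IH P1.
have : 0 <= (1 - p) * (1 - a n) by rewrite mulr_ge0 // subr_ge0.
by move=> h; nra.
Qed.

(** Convergence of an infinite product with positive factors: the head is
    positive and the tail is at least one half by Weierstrass' inequality. *)
Lemma prod_lower_bound (R : realType) (a : nat -> R) (C r : R) :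
  0 < r < 1 -> (forall i, 0 < a i <= 1) -> (forall i, 1 - a i <= C * r ^+ i) ->
  exists2 d : R, 0 < d & forall n, d <= \prod_(i < n) a i.
Proof.
move=> /andP[r0 r1] a01 aC.
have C0 : 0 <= C.
  have := aC 0%N; rewrite expr0 mulr1; apply: le_trans.
  by rewrite subr_ge0; have /andP[] := a01 0%N.
have [n0 Hn0] : exists n0, C * r ^+ n0 * (1 - r)^-1 <= 2^-1.
  have rr : `|r| < 1 by rewrite gtr0_norm.
  have := cvg_expr rr.
  move=> /(cvgM (cvg_cst (C * (1 - r)^-1 : R))); rewrite mulr0.
  have h2 : (0 : R) < 2^-1 by [].
  move=> /cvgrPdist_le /(_ _ h2)[n0 _ /(_ n0 (leqnn _))].
  rewrite sub0r normrN => h; exists n0; apply: le_trans h.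
  by rewrite mulrAC; apply: ler_norm.
have p0 k : 0 < \prod_(i < k) a i.
  by apply: prodr_gt0 => i _; have /andP[] := a01 i.
exists ((\prod_(i < n0) a i) / 2) => [|n]; first by rewrite divr_gt0.
have le1 : \prod_(i < n) a (n0 + i)%N >= 2^-1.
  apply: le_trans (@prod_ge_1Bsum R (fun i => a (n0 + i)%N) n _); last first.
    by move=> i; have /andP[/ltW -> ->] := a01 (n0 + i)%N.
  have : \sum_(i < n) (1 - a (n0 + i)%N) <= 2^-1.
    apply: le_trans Hn0.
    apply: (@le_trans _ _ (\sum_(i < n) C * r ^+ n0 * r ^+ i)).
      by apply: ler_sum => i _; rewrite -mulrA -exprD.
    rewrite -mulr_sumr ler_wpM2l ?mulr_ge0 ?exprn_ge0 ?(ltW r0) //.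
    by rewrite geom_sum_le // (ltW r0) r1.
  by move=> h; lra.
apply: (@le_trans _ _ (\prod_(i < n0 + n) a i)).
  by rewrite big_split_ord /= ler_wpM2l ?(ltW (p0 _)).
rewrite addnC big_split_ord /= ler_piMr ?(ltW (p0 _)) //.
by apply: prodr_ile1 => i _; have /andP[/ltW -> ->] := a01 (n + i)%N.
Qed.

Lemma cnorm_prodB_le (R : realType) n (a b : 'I_n -> R[i]) :
  (forall i, cnorm (a i) <= 1) -> (forall i, cnorm (b i) <= 1) ->
  cnorm (\prod_i a i - \prod_i b i) <= \sum_i cnorm (a i - b i).
Proof.
elim: n a b => [|n IH] a b a1 b1; first by rewrite !big_ord0 subrr cnorm0.
rewrite !big_ord_recl /=.
set p := \prod_(i < n) _; set q := \prod_(i < n) _.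
have -> : a ord0 * p - b ord0 * q = (a ord0 - b ord0) * p + b ord0 * (p - q).
  by ring.
apply: le_trans (cnormD _ _) _; rewrite !cnormM; apply: lerD.
  rewrite ler_piMr ?cnorm_ge0 // /p cnorm_prod.
  by apply: prodr_ile1 => i _; rewrite cnorm_ge0 a1.
apply: le_trans (IH _ _ (fun i => a1 _) (fun i => b1 _)).
by rewrite ler_piMl ?cnorm_ge0.
Qed.

(** With truncated subtraction, the exponent is the distance between i and p. *)
Lemma sum_geom_dist_le (R : realFieldType) (r : R) n p : 0 < r < 1 ->
  \sum_(i < n) r ^+ ((i - p) + (p - i)) <= 2 / (1 - r).
Proof.
move=> /andP[r0 r1].
have r01 : 0 <= r < 1 by rewrite (ltW r0).
apply: (@le_trans _ _ (\sum_(i < p + n) r ^+ ((i - p) + (p - i)))).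
  rewrite addnC big_split_ord /= lerDl.
  by apply: sumr_ge0 => i _; rewrite exprn_ge0 // ltW.
rewrite big_split_ord /= (_ : 2 = 1 + 1) // mulrDl mul1r; apply: lerD; last first.
  apply: le_trans (geom_sum_le n r01); apply: ler_sum => i _ /=.
  by rewrite addKn (_ : (p - (p + i))%N = 0%N) ?addn0 //; lia.
apply: le_trans (geom_sum_le p r01).
rewrite [leRHS](reindex_inj rev_ord_inj); apply: ler_sum => i _ /=.
apply: ler_wiXn2l; [exact: ltW | exact: ltW |].
by case: i => i /=; lia.
Qed.

(** Expanding the square leaves J correlations of a function with itself and
    at most J^2 correlations of different functions. *)
Lemma second_moment_bound (R : realType) (T : finType) J (Z : 'I_J -> T -> R[i])
    (D M : R) : 0 <= M ->
  (forall j, cnorm (\sum_w Z j w * ((Z j w)^*)%C) <= D) ->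
  (forall j l, j != l -> cnorm (\sum_w Z j w * ((Z l w)^*)%C) <= M) ->
  \sum_w cnorm (\sum_j Z j w) ^+ 2 <= J%:R * D + J%:R ^+ 2 * M.
Proof.
move=> M0 diag off.
have S0 : 0 <= \sum_w cnorm (\sum_j Z j w) ^+ 2.
  by apply: sumr_ge0 => w _; apply: sqr_ge0.
rewrite -[leLHS]ger0_norm // -cnorm_real rmorph_sum /=.
have -> : \sum_w (cnorm (\sum_j Z j w) ^+ 2)%:C%C =
    \sum_j \sum_l \sum_w Z j w * ((Z l w)^*)%C.
  rewrite exchange_big /=; under [RHS]eq_bigr => l _ do rewrite exchange_big /=.
  rewrite exchange_big /=; apply: eq_bigr => w _.
  rewrite cnorm_sqr rmorph_sum /= big_distrlr /= exchange_big /=.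
  by [].
apply: le_trans (cnorm_sum _ _ _) _.
apply: (@le_trans _ _ (\sum_(j < J) (D + J%:R * M))).
  apply: ler_sum => j _; apply: le_trans (cnorm_sum _ _ _) _.
  rewrite (bigD1 j) //=; apply: lerD => //.
  apply: (@le_trans _ _ (\sum_(l < J | l != j) M)).
    by apply: ler_sum => l lj; apply: off; rewrite eq_sym.
  rewrite -[J in J%:R]card_ord mulr_natl -sumr_const [leRHS](bigD1 j) //=.
  by rewrite lerDr.
rewrite sumr_const card_ord -[leLHS]mulr_natl mulrDr mulrA -expr2; exact: lexx.
Qed.

(** * Pisot resonances: large and nearly independent characters *)

(** With u and v the distances from i to p and q, u + v is at least B; hence
    4 max(u, v) >= 2 u + 2 v >= B + u. This is how a bound by the larger of two
    distances becomes both small in B and summable in i. *)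
Lemma dist_exponent_far i p q B : (B <= (p - q) + (q - p))%N ->
  ((i - p) + (p - i) <= (i - q) + (q - i))%N ->
  (B + ((i - p) + (p - i)) <= 4 * ((i - q) + (q - i)))%N.
Proof. lia. Qed.

Lemma dist_exponent_near i p q B : (B <= (p - q) + (q - p))%N ->
  ((i - q) + (q - i) <= (i - p) + (p - i))%N ->
  (B + ((i - p) + (p - i)) <= 4 * ((i - p) + (p - i)))%N.
Proof. lia. Qed.

Section PisotTransform.
Variables (R : realType) (beta : R) (m : nat).
Hypothesis beta_pisot : pisot beta.
Hypothesis lt_beta_m : beta < m%:R.

Let beta1 : 1 < beta := pisot_gt1 beta_pisot.
Let b0 : 0 < beta. Proof. exact: lt_trans ltr01 beta1. Qed.
Let bN0 : beta != 0. Proof. by rewrite gt_eqF. Qed.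
Let m0 : (0 < m)%N.
Proof. by rewrite -(ltr_nat R); apply: lt_trans b0 lt_beta_m. Qed.

Let pow_quotient_le i p : (i <= p)%N ->
  beta ^+ i * beta ^- p = beta ^- (p - i).
Proof.
by move=> ip; rewrite -{1}(subnK ip) exprD; field; rewrite !expf_neq0.
Qed.

Let pow_quotient_ge i p : (p <= i)%N ->
  beta ^+ i * beta ^- p = beta ^+ (i - p).
Proof. by move=> pi; rewrite -{1}(subnK pi) exprD mulfK // expf_neq0. Qed.

(** Negative powers of beta are near 0 and positive powers are near their
    traces. The factor 4 in the exponent is obtained by taking a fourth root; it
    leaves room for [dist_exponent_far]. *)
Lemma pisot_two_sided_near_int : exists (C r : R), [/\ 0 < r < 1, 0 <= C &
  forall i p : nat, exists k : int,
    `|beta ^+ i * beta ^- p - k%:~R| <= C * r ^+ (4 * ((i - p) + (p - i)))].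
Proof.
have [C [r [/andP[r0 r1] C0 near]]] := pisot_near_int beta_pisot.
(* This rate serves both for positive and for negative powers of beta. *)
pose u := Num.max r beta^-1.
have u0 : 0 < u by rewrite lt_max r0.
have u1 : u < 1 by rewrite gt_max r1 invf_lt1.
exists (Num.max 1 C), (Num.sqrt (Num.sqrt u)); split.
- rewrite !sqrtr_gt0 u0 /=.
  by rewrite -{1}[1]sqrtr1 ltr_sqrt ?sqrtr_gt0 // -{1}[1]sqrtr1 ltr_sqrt.
- by rewrite le_max ler01.
move=> i p; rewrite exprM [X in X ^+ (_ + _)](_ : _ = u); last first.
  by rewrite (exprM _ 2 2) !sqr_sqrtr ?sqrtr_ge0 // ltW.
have [ip|pi] := ltnP i p.
  exists 0; rewrite subr0.
  rewrite pow_quotient_le ?(ltnW ip) // -exprVn.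
  have -> : ((i - p) + (p - i) = p - i)%N.
    by rewrite (eqP (ltnW ip : i - p == 0)%N).
  rewrite ger0_norm ?exprn_ge0 ?invr_ge0 ?(ltW b0) //.
  apply: (@le_trans _ _ (1 * u ^+ (p - i))).
    by rewrite mul1r lerXn2r ?nnegrE ?invr_ge0 ?(ltW b0) ?(ltW u0) // le_max lexx orbT.
  by rewrite ler_wpM2r ?exprn_ge0 ?(ltW u0) // le_max lexx.
have [k hk] := near (i - p)%N; exists k.
rewrite pow_quotient_ge //.
have -> : ((i - p) + (p - i) = i - p)%N.
  by rewrite (eqP (pi : p - i == 0)%N) addn0.
apply: le_trans hk _; apply: ler_pM; rewrite ?exprn_ge0 ?(ltW r0) //.
  by rewrite le_max lexx orbT.
by rewrite lerXn2r ?nnegrE ?(ltW r0) ?(ltW u0) // le_max lexx.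
Qed.

Local Notation phi := (digit_transform m).

(** The mean of the character of frequency x over the values of the words of
    length n, see [word_value_transform]. *)
Definition mean_transform n x : R[i] := \prod_(i < n) phi (beta ^+ i * x).

Lemma mean_transform_le1 n x : cnorm (mean_transform n x) <= 1.
Proof.
rewrite /mean_transform cnorm_prod; apply: prodr_ile1 => i _.
by rewrite cnorm_ge0 digit_transform_le1.
Qed.

Hypothesis not_dvd : ~ (exists b : nat, beta = b%:R /\ (b %| m)%N).

(** If m beta^j is an integer for some nonzero j, then beta is an integer by
    [pisot_pow_rational]; for j > 0 the power beta^j is then an integer too,
    where phi is 1, and for j < 0 the integer beta divides m. *)
Lemma digit_transform_pow_neq0 i p : phi (beta ^+ i * beta ^- p) != 0.
Proof.
apply/eqP => /(digit_transform_eq0 m0) [[k Ek] nint].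
have mN0 : (Posz m) != 0 by rewrite -lt0n.
have [pi|ip] := leqP p i.
  have E := pow_quotient_ge pi.
  rewrite E in Ek nint; have [h|h] := posnP (i - p).
    by apply: nint; exists 1; rewrite h expr0.
  have [b Eb] := pisot_pow_rational beta_pisot h mN0 Ek.
  by apply: nint; exists (Posz (b ^ (i - p))); rewrite Eb -pmulrn natrX.
have E := pow_quotient_le (ltnW ip).
have bp : beta ^+ (p - i) != 0 by rewrite expf_neq0.
rewrite E in Ek; have {}Ek : k%:~R * beta ^+ (p - i) = (Posz m)%:~R.
  by rewrite -Ek -mulrA mulVf // mulr1.
have k0 : k != 0.
  by apply/eqP => k0; move/eqP: Ek; rewrite k0 mul0r eq_sym intr_eq0 (negPf mN0).
have h : (0 < p - i)%N by rewrite subn_gt0.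
have [b Eb] := pisot_pow_rational beta_pisot h k0 Ek.
apply: not_dvd; exists b; split => //.
move: Ek; rewrite Eb -natrX -[(_ ^ _)%N%:R]/((Posz (b ^ (p - i)))%:~R) -intrM.
move/eqP; rewrite eqr_int => /eqP/(congr1 absz); rewrite abszM /= => <-.
by rewrite dvdn_mull // -(prednK h) expnS dvdn_mulr.
Qed.

(** The factors are nonzero, and they tend exponentially fast to 1 on both sides
    of i = p because beta^(i - p) is near an integer. *)
Lemma mean_transform_lower_bound : exists2 d : R, 0 < d &
  forall n p, (p <= n)%N -> d <= cnorm (mean_transform n (beta ^- p)).
Proof.
have [C [r [/andP[r0 r1] C0 near]]] := pisot_two_sided_near_int.
pose A (n : nat) := cnorm (phi (beta ^+ n * beta ^- 0)).
pose A' (n : nat) := cnorm (phi (beta ^+ 0 * beta ^- n.+1)).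
have pos x : phi x != 0 -> 0 < cnorm (phi x) <= 1.
  move=> h; rewrite digit_transform_le1 // andbT lt_neqAle cnorm_ge0 andbT.
  by apply: contra_neq h => /esym/ComplexField.Normc.eq0_normc.
pose C' := 2 * pi * m%:R * C.
have C'0 : 0 <= 2 * pi * m%:R :> R by rewrite !mulr_ge0 // pi_ge0.
have r4 (n : nat) : r ^+ (4 * n) <= r ^+ n.
  by rewrite ler_wiXn2l ?(ltW r0) ?(ltW r1) //; lia.
have rate i p n : (n <= (i - p) + (p - i))%N ->
    1 - cnorm (phi (beta ^+ i * beta ^- p)) <= C' * r ^+ n.
  move=> hn; have [k hk] := near i p.
  have := digit_transform_near_int m0 (beta ^+ i * beta ^- p) k.
  rewrite lerBlDr -lerBlDl => h; apply: le_trans h _.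
  rewrite /C' -[leRHS]mulrA; apply: ler_wpM2l => //; apply: le_trans hk _.
  apply: ler_wpM2l => //; apply: le_trans (r4 _) _.
  by rewrite ler_wiXn2l ?(ltW r0) ?(ltW r1).
have r01 : 0 < r < 1 by rewrite r0.
have [d d0 dP] : exists2 d : R, 0 < d & forall n, d <= \prod_(i < n) A i.
  apply: (@prod_lower_bound R A C' r) => // i; first exact/pos/digit_transform_pow_neq0.
  by apply: rate; lia.
have [d' d'0 dP'] : exists2 d : R, 0 < d & forall n, d <= \prod_(i < n) A' i.
  apply: (@prod_lower_bound R A' C' r) => // i; first exact/pos/digit_transform_pow_neq0.
  by apply: rate; lia.
exists (d' * d) => [|n p pn]; first exact: mulr_gt0.
rewrite /mean_transform cnorm_prod -(subnKC pn) big_split_ord /=.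
apply: ler_pM; rewrite ?(ltW d0) ?(ltW d'0) //.
  apply: le_trans (dP' p) _; rewrite (reindex_inj rev_ord_inj) /=.
  rewrite le_eqVlt; apply/orP; left; apply/eqP; apply: eq_bigr => i _.
  by rewrite /A' mul1r subnSK // pow_quotient_le // ltnW.
apply: le_trans (dP (n - p)%N) _.
rewrite le_eqVlt; apply/orP; left; apply/eqP; apply: eq_bigr => i _.
by rewrite /A expr0 invr1 mulr1 exprD mulrAC mulfV ?mul1r // expf_neq0.
Qed.

(** Factor by factor, by [digit_transform_cov] the i-th error is small as soon
    as beta^(i - p) or beta^(i - q) is near an integer, which fails only when i
    is close to both p and q. *)
Lemma mean_transform_decorrelation : exists (D r : R), [/\ 0 < r < 1, 0 <= D &
  forall n p q B, (B <= (p - q) + (q - p))%N ->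
    cnorm (mean_transform n (beta ^- p - beta ^- q) -
      mean_transform n (beta ^- p) * ((mean_transform n (beta ^- q))^*)%C)
    <= D * r ^+ B].
Proof.
have [C [r [/andP[r0 r1] C0 near]]] := pisot_two_sided_near_int.
pose E := 4 * pi * m%:R * C.
have E'0 : 0 <= 4 * pi * m%:R :> R by rewrite !mulr_ge0 // pi_ge0.
have E0 : 0 <= E by rewrite /E mulr_ge0.
have r01 : 0 < r < 1 by rewrite r0.
exists (E * (2 / (1 - r))), r; split => //.
  by rewrite mulr_ge0 // divr_ge0 // subr_ge0 ltW.
move=> n p q B hB.
rewrite /mean_transform rmorph_prod -big_split /=.
apply: le_trans (cnorm_prodB_le _ _) _.
- by move=> i; apply: digit_transform_le1.
- move=> i; rewrite cnormM cnorm_conj mulr_ile1 ?cnorm_ge0 //;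
  exact: digit_transform_le1.
apply: (@le_trans _ _ (\sum_(i < n) E * r ^+ B * r ^+ ((i - p) + (p - i)))).
  apply: ler_sum => i _; rewrite mulrBr.
  set x := _ * beta ^- p; set y := _ * beta ^- q.
  have [k hk] := near i p; have [l hl] := near i q.
  have h1 := digit_transform_cov m0 x y k.
  have h2 : cnorm (phi (x - y) - phi x * ((phi y)^*)%C) <=
      4 * pi * m%:R * `|y - l%:~R|.
    rewrite -cnorm_conj rmorphB /= [((phi x * _)^*)%C]rmorphM /= conjcK.
    rewrite -digit_transformN // opprB mulrC; exact: digit_transform_cov.
  have [uv|vu] := leqP ((i - p) + (p - i)) ((i - q) + (q - i)).
    apply: le_trans h2 _; rewrite /E -[leRHS]mulrA -[leRHS]mulrA; apply: ler_wpM2l => //.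
    apply: le_trans hl _; apply: ler_wpM2l => //; rewrite -exprD.
    by apply: ler_wiXn2l; [exact: ltW | exact: ltW | exact: dist_exponent_far].
  apply: le_trans h1 _; rewrite /E -[leRHS]mulrA -[leRHS]mulrA; apply: ler_wpM2l => //.
  apply: le_trans hk _; apply: ler_wpM2l => //; rewrite -exprD.
  by apply: ler_wiXn2l; [exact: ltW | exact: ltW | exact: dist_exponent_near (ltnW vu)].
rewrite -mulr_sumr mulrAC ler_wpM2r ?exprn_ge0 ?(ltW r0) //.
by rewrite ler_wpM2l // sum_geom_dist_le.
Qed.

End PisotTransform.

(** * Values of words on a grid *)

Section Grid.
Variables (R : realType) (beta : R) (m : nat).
Hypothesis beta_pisot : pisot beta.
Let beta1 : 1 < beta := pisot_gt1 beta_pisot.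
Let b0 : 0 < beta. Proof. exact: lt_trans ltr01 beta1. Qed.

(** The difference of two values is an integer polynomial at beta with
    coefficients bounded by m. *)
Lemma word_value_separated : exists2 h : R, 0 < h &
  forall n (u w : n.-tuple 'I_m),
    `|word_value beta u - word_value beta w| < h ->
    word_value beta u = word_value beta w.
Proof.
have [h h0 hP] := pisot_int_poly_lower_bound beta_pisot m.
exists h => // n u w; rewrite ltNge => huw; apply/eqP; rewrite -subr_eq0.
apply/negPn/negP => uw; case/negP: huw.
(* Coefficients are read from the last digit, which has weight 1. *)
pose dig (v : n.-tuple 'I_m) k : int := Posz (nth 0%N (map val v) (n - k.+1)).
have dm v k : 0 <= dig v k <= m%:Z.
  rewrite /dig; have [h1|h1] := ltnP (n - k.+1) (size (map val v)); last first.
    by rewrite nth_default.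
  have := mem_nth 0%N h1 => /mapP[d _ ->]; have := ltn_ord d.
  by rewrite /= lez_nat => /ltnW ->.
pose A := \poly_(k < n) (dig u k - dig w k).
have sA : (size (map_poly (intr : int -> R) A) <= n)%N.
  by apply: leq_trans (size_poly _ _) _; apply: size_poly.
have E : (map_poly intr A).[beta] = word_value beta u - word_value beta w.
  rewrite (horner_coef_wide _ sA) /word_value -sumrB (reindex_inj rev_ord_inj) /=.
  apply: eq_bigr => i _; rewrite coef_map coef_poly /= -mulrBl.
  have -> : (n - i.+1 < n)%N by case: i => i /=; lia.
  congr (_ * _); rewrite rmorphB /= /dig.
  have -> : (n - (n - i.+1).+1 = i)%N by case: i => i /=; lia.
  by rewrite !(nth_map (tnth u i)) ?size_tuple // -!tnth_nth.
rewrite -E; apply: hP; last by rewrite E.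
move=> k; rewrite coef_poly; case: ifP => _; last by rewrite normr0.
have := dm u k; have := dm w k; lia.
Qed.

Lemma word_value_ge0 n (w : n.-tuple 'I_m) : 0 <= word_value beta w.
Proof. by apply: sumr_ge0 => i _; rewrite mulr_ge0 // exprn_ge0 // ltW. Qed.

Lemma word_value_le n (w : n.-tuple 'I_m) :
  word_value beta w <= m%:R / (beta - 1) * beta ^+ n.
Proof.
have B0 : 0 < beta - 1 by rewrite subr_gt0.
apply: (@le_trans _ _ (\sum_(i < n) m%:R * beta ^+ (n - i.+1))).
  apply: ler_sum => i _; rewrite ler_wpM2r ?exprn_ge0 ?(ltW b0) //.
  by rewrite ler_nat ltnW.
rewrite -mulr_sumr mulrAC -mulrA ler_wpM2l // ler_pdivlMr //.
rewrite (reindex_inj rev_ord_inj) /=.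
rewrite (eq_bigr (fun i : 'I_n => beta ^+ i)) => [|i _]; last first.
  by congr (_ ^+ _); case: i => i /=; lia.
by rewrite mulrC -subrX1 gerBl.
Qed.

(** By separation, a cell of side h contains at most one value. The words w of
    this value have total weight at most 1 when each is weighted by 1/c(w). *)
Lemma grid_bound : exists (h C : R), [/\ 0 < h, h <= 1, 0 < C &
  forall n, exists2 N : nat, N%:R <= C * beta ^+ n &
    forall G : nat -> R, (forall i, 0 <= G i) ->
    \sum_(w : n.-tuple 'I_m) (multiplicity beta w)%:R^-1 *
      G (Num.truncn (word_value beta w / h)) <= \sum_(i < N) G i].
Proof.
have [h' h'0 sep'] := word_value_separated.
pose h := Num.min h' 1.
have h0 : 0 < h by rewrite lt_min h'0 ltr01.
have B0 : 0 < beta - 1 by rewrite subr_gt0.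
pose W : R := m%:R / (beta - 1).
have W0 : 0 <= W by rewrite divr_ge0 // ltW.
exists h, (W / h + 1); split=> //; first by rewrite /h ge_min lexx orbT.
  by rewrite ltr_wpDl // divr_ge0 // ltW.
move=> n; set v := fun w : n.-tuple 'I_m => word_value beta w / h.
have v0 w : 0 <= v w by rewrite divr_ge0 ?word_value_ge0 // ltW.
pose N := (Num.truncn (W * beta ^+ n / h)).+1.
have idxN w : (Num.truncn (v w) < N)%N.
  rewrite truncn_lt_nat //; apply: le_lt_trans (truncnS_gt _).
  by rewrite ler_pM2r ?invr_gt0 // word_value_le.
have W'0 : 0 <= W * beta ^+ n / h.
  by rewrite mulr_ge0 ?invr_ge0 ?(ltW h0) // mulr_ge0 // exprn_ge0 // ltW.
exists N.
  rewrite /N -natr1 mulrDl mul1r; apply: lerD.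
    have -> : W / h * beta ^+ n = W * beta ^+ n / h by rewrite mulrAC.
    by have /andP[] := truncn_itv W'0.
  by rewrite exprn_ege1 // ltW.
have idx_eq u w : Num.truncn (v u) = Num.truncn (v w) ->
    word_value beta u = word_value beta w.
  move=> E; apply: sep'; apply: (@lt_le_trans _ _ h); last by rewrite /h ge_min lexx.
  have -> : word_value beta u - word_value beta w = (v u - v w) * h.
    by rewrite /v mulrBl !divfK ?gt_eqF.
  rewrite normrM (gtr0_norm h0) gtr_pMl //.
  have /andP[lu hu] := truncn_itv (v0 u); have /andP[lw hw] := truncn_itv (v0 w).
  rewrite E in lu hu; rewrite -natr1 in hu hw.
  by rewrite ltr_norml; apply/andP; split; lra.
move=> G G0; pose idx w : 'I_N := inord (Num.truncn (v w)).
rewrite (partition_big idx xpredT) //=; apply: ler_sum => i _.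
have [w0 /eqP w0i|none] := pickP (fun w => idx w == i); last first.
  by rewrite big_pred0.
have iE w : idx w == i -> Num.truncn (v w) = i.
  by move=> /eqP <-; rewrite /idx inordK.
rewrite (eq_bigr (fun=> (multiplicity beta w0)%:R^-1 * G i)) => [|w wi]; last first.
  rewrite -/(v w) (iE w wi); congr (_ %:R^-1 * _).
  apply: eq_card => u; rewrite !inE; congr (_ == _).
  by apply: idx_eq; rewrite !iE // w0i.
rewrite sumr_const -[leLHS]mulr_natl mulrA ler_piMl //.
rewrite ler_pdivrMr ?mul1r ?ltr0n ?multiplicity_gt0 // ler_nat.
apply/subset_leq_card/fintype.subsetP => u; rewrite !inE => ui.
by apply/eqP/idx_eq; rewrite !iE // w0i.
Qed.

Lemma affinity_bound : exists2 C : R, 0 <= C & forall n,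
  affinity beta m n <= C * Num.sqrt (m%:R * beta) ^+ n.
Proof.
have [h [C [_ _ C0 grid]]] := grid_bound.
exists (Num.sqrt C) => [|n]; first exact: sqrtr_ge0.
have [N NC HN] := grid n.
have := @sum_cauchy_schwarz R _
  (fun w : n.-tuple 'I_m => (Num.sqrt (multiplicity beta w)%:R)^-1) (fun=> 1).
under eq_bigr => w _ do rewrite mulr1.
move/le_trans; apply.
have -> : \sum_(w : n.-tuple 'I_m) (1 : R) ^+ 2 = m%:R ^+ n.
  by rewrite expr1n sumr_const card_tuple card_ord natrX.
rewrite -[Num.sqrt (m%:R * beta) ^+ n]ger0_norm ?exprn_ge0 ?sqrtr_ge0 //.
rewrite -sqrtr_sqr -exprM mulnC exprM sqr_sqrtr; last by rewrite mulr_ge0 // ltW.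
rewrite -!sqrtrM ?(ltW C0) //; last first.
  by apply: sumr_ge0 => w _; rewrite sqr_ge0.
apply: ler_wsqrtr; rewrite exprMn mulrCA mulrC ler_wpM2l ?exprn_ge0 //.
apply: le_trans NC.
have := HN (fun=> 1) (fun=> ler01); rewrite sumr_const card_ord; apply: le_trans.
apply: ler_sum => w _; rewrite mulr1 exprVn sqr_sqrtr //.
Qed.

End Grid.

(** * A strict bound on the affinity *)

Lemma geometric_eventually_small (R : realType) (c r e : R) :
  0 <= r < 1 -> 0 < e -> exists n0 : nat, forall n, (n0 <= n)%N -> c * r ^+ n <= e.
Proof.
move=> /andP[r0 r1] e0.
have rr : `|r| < 1 by rewrite ger0_norm.
have := cvg_expr rr; move=> /(cvgM (cvg_cst (c : R))); rewrite mulr0.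
move=> /cvgrPdist_le /(_ _ e0)[n0 _ H]; exists n0 => n /H /=.
rewrite sub0r normrN; apply: le_trans; exact: ler_norm.
Qed.

(** The diagonal terms give N / J. The other correlations are geometric sums,
    bounded independently of N because the frequencies are distinct modulo 1;
    M is therefore fixed before N. *)
Lemma exponential_sum_grid (R : realType) J (xi : 'I_J -> R) :
  (0 < J)%N -> (forall j l, j != l -> 0 < `|xi j - xi l| < 1) ->
  exists2 M : R, 0 <= M & forall N (c : 'I_J -> R[i]),
    (forall j, cnorm (c j) <= 1) ->
    \sum_(i < N) cnorm (\sum_j J%:R^-1 * (c j * cexp (xi j * i%:R))) ^+ 2 <=
      N%:R / J%:R + M.
Proof.
move=> J0 xiP.
have JR : 0 < J%:R :> R by rewrite ltr0n.
pose g j l := 2 / cnorm (cexp (xi j - xi l) - 1).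
have g0 j l : 0 <= g j l by rewrite divr_ge0 ?cnorm_ge0.
pose M := \sum_j \sum_l g j l.
have M0 : 0 <= M by apply: sumr_ge0 => j _; apply: sumr_ge0 => l _.
have gM j l : g j l <= M.
  rewrite /M (bigD1 j) //= (bigD1 l) //= -addrA lerDl addr_ge0 //.
    by apply: sumr_ge0.
  by apply: sumr_ge0 => k _; apply: sumr_ge0.
exists M => // N c c1.
pose Z (j : 'I_J) (i : 'I_N) : R[i] := J%:R^-1 * (c j * cexp (xi j * i%:R)).
have ZZ j l : cnorm (\sum_i Z j i * ((Z l i)^*)%C) <=
    J%:R^-2 * cnorm (\sum_(i < N) cexp ((xi j - xi l) * i%:R)).
  have -> : \sum_i Z j i * ((Z l i)^*)%C = (J%:R^-1 * c j) * ((J%:R^-1 * c l)^*)%C *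
      \sum_(i < N) cexp ((xi j - xi l) * i%:R).
    rewrite mulr_sumr; apply: eq_bigr => i _.
    rewrite mulrBl cexpD cexpN /Z !rmorphM /=.
    set a := (J%:R^-1)^*%C; set b := ((c l)^*)%C; set e := (_ -i* _)%C.
    by ring.
  rewrite !cnormM cnorm_conj cnormM cnorm_natV ler_wpM2r ?cnorm_ge0 // mulrACA.
  rewrite -expr2 exprVn ler_piMr ?invr_ge0 ?exprn_ge0 // mulr_ile1 ?cnorm_ge0 //.
have diag j : cnorm (\sum_i Z j i * ((Z j i)^*)%C) <= J%:R^-2 * N%:R.
  apply: le_trans (ZZ j j) _; rewrite ler_wpM2l ?invr_ge0 ?exprn_ge0 //.
  rewrite (eq_bigr (fun=> 1)) => [|i _]; last by rewrite subrr mul0r cexp0.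
  by rewrite sumr_const card_ord -(rmorph_nat (real_complex R)) cnorm_real normr_nat.
have off j l : j != l -> cnorm (\sum_i Z j i * ((Z l i)^*)%C) <= J%:R^-2 * M.
  move=> jl; apply: le_trans (ZZ j l) _; rewrite ler_wpM2l ?invr_ge0 ?exprn_ge0 //.
  by apply: le_trans (geometric_cexp_bound _ (cexp_neq1 (xiP _ _ jl))) (gM j l).
have JM0 : 0 <= J%:R^-2 * M by rewrite mulr_ge0 // invr_ge0 exprn_ge0.
apply: le_trans (second_moment_bound JM0 diag off) _.
rewrite le_eqVlt; apply/orP; left; apply/eqP; field.
by rewrite lt0r_neq0.
Qed.

Section StrictBound.
Variables (R : realType) (beta : R) (m : nat).
Hypothesis beta_pisot : pisot beta.
Hypothesis lt_beta_m : beta < m%:R.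
Let beta1 : 1 < beta := pisot_gt1 beta_pisot.
Let b0 : 0 < beta. Proof. exact: lt_trans ltr01 beta1. Qed.
Let m0 : (0 < m)%N.
Proof. by rewrite -(ltr_nat R); apply: lt_trans b0 lt_beta_m. Qed.

(** The average of J characters of frequencies beta^-p, p = B, 2B, ..., JB, each
    weighted by the conjugate of its mean so that all the means become
    nonnegative real numbers instead of cancelling each other. *)
Definition resonance K J B x : R[i] :=
  \sum_(j < J) J%:R^-1 *
    (((mean_transform beta m K (beta ^- (j.+1 * B)))^*)%C *
     cexp (beta ^- (j.+1 * B) * x)).

(** The mean of [resonance] over the values of words. *)
Definition resonance_level K J B : R :=
  \sum_(j < J) J%:R^-1 * cnorm (mean_transform beta m K (beta ^- (j.+1 * B))) ^+ 2.

(** A variance bound: the covariances of the characters are bounded by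
    [mean_transform_decorrelation], since two of the exponents differ by at
    least B. *)
Lemma resonance_concentration : exists (D r : R), [/\ 0 < r < 1, 0 <= D &
  forall K J B, (0 < J)%N ->
  \sum_(w : K.-tuple 'I_m)
    cnorm ((resonance_level K J B)%:C%C - resonance K J B (word_value beta w)) ^+ 2
  <= m%:R ^+ K * (J%:R^-1 + D * r ^+ B)].
Proof.
have [D [r [r01 D0 dec]]] := mean_transform_decorrelation beta_pisot lt_beta_m.
exists D, r; split => // K J B J0.
have JR : 0 < J%:R :> R by rewrite ltr0n.
pose xi (j : 'I_J) : R := beta ^- (j.+1 * B).
pose c j := mean_transform beta m K (xi j).
have c1 j : cnorm (c j) <= 1 by exact: mean_transform_le1.
pose e j (w : K.-tuple 'I_m) := cexp (xi j * word_value beta w).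
pose Z j w := J%:R^-1 * ((c j)^*)%C * (c j - e j w).
have level w : (resonance_level K J B)%:C%C - resonance K J B (word_value beta w)
    = \sum_j Z j w.
  rewrite /resonance_level /resonance rmorph_sum -sumrB; apply: eq_bigr => j _ /=.
  rewrite rmorphM /= -/(xi j) -/(c j) -/(e j w).
  rewrite fmorphV rmorph_nat cnorm_sqr /Z.
  by ring.
under eq_bigr => w _ do rewrite level.
have mK : (m%:R : R[i]) ^+ K = (m%:R ^+ K : R)%:C%C.
  by rewrite rmorphXn /= rmorph_nat.
have se j : \sum_w e j w = m%:R ^+ K * c j by exact: word_value_transform.
have see j l : \sum_w e j w * ((e l w)^*)%C =
    m%:R ^+ K * mean_transform beta m K (xi j - xi l).
  rewrite -(word_value_transform m0); apply: eq_bigr => w _.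
  by rewrite /e -cexpN -cexpD mulrBl.
have cov j l : \sum_w Z j w * ((Z l w)^*)%C =
    J%:R^-1 * ((c j)^*)%C * ((J%:R^-1 * ((c l)^*)%C)^*)%C * (m%:R ^+ K *
      (mean_transform beta m K (xi j - xi l) - c j * ((c l)^*)%C)).
  have -> : m%:R ^+ K * (mean_transform beta m K (xi j - xi l) - c j * ((c l)^*)%C)
      = \sum_w (c j - e j w) * ((c l - e l w)^*)%C.
    have -> : \sum_w (c j - e j w) * ((c l - e l w)^*)%C =
        \sum_(w : K.-tuple 'I_m) (c j * ((c l)^*)%C) - (\sum_w e j w) * ((c l)^*)%C
        - c j * ((\sum_w e l w)^*)%C + \sum_w e j w * ((e l w)^*)%C.
      rewrite rmorph_sum /= mulr_suml mulr_sumr -!sumrB -big_split /=.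
      by apply: eq_bigr => w _; rewrite rmorphB /=; ring.
    rewrite !se see sumr_const card_tuple card_ord rmorphM rmorphXn rmorph_nat /=.
    have E (z : R[i]) : z *+ (m ^ K) = m%:R ^+ K * z by rewrite -[LHS]mulr_natl natrX.
    by rewrite E; ring.
  rewrite mulr_sumr; apply: eq_bigr => w _.
  by rewrite /Z !rmorphM /=; ring.
have covB j l : cnorm (\sum_w Z j w * ((Z l w)^*)%C) <= J%:R^-2 * m%:R ^+ K *
    cnorm (mean_transform beta m K (xi j - xi l) - c j * ((c l)^*)%C).
  rewrite cov !cnormM !cnorm_conj !cnormM !cnorm_conj cnorm_natV mK cnorm_real.
  rewrite (ger0_norm (exprn_ge0 _ _)) // mulrA ler_wpM2r ?cnorm_ge0 //.
  rewrite ler_wpM2r ?exprn_ge0 // mulrACA -expr2 exprVn ler_piMr //.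
  by rewrite mulr_ile1 ?cnorm_ge0.
have mK0 : 0 <= m%:R ^+ K :> R by rewrite exprn_ge0.
have J20 : 0 <= (J%:R ^- 2 : R) by rewrite invr_ge0 exprn_ge0.
have diag j : cnorm (\sum_w Z j w * ((Z j w)^*)%C) <= J%:R^-2 * m%:R ^+ K.
  apply: le_trans (covB j j) _; rewrite ler_piMr ?mulr_ge0 //.
  rewrite subrr /mean_transform (eq_bigr (fun=> 1)) => [|i _]; last first.
    by rewrite mulr0 (digit_transform_int R m0 0).
  rewrite big1 // -cnorm_sqr -[1](rmorph1 (real_complex R)) -rmorphB cnorm_real.
  rewrite ger0_norm ?gerBl ?sqr_ge0 // subr_ge0.
  by rewrite -[1](expr1n _ 2) lerXn2r ?nnegrE ?cnorm_ge0.
have off j l : j != l -> cnorm (\sum_w Z j w * ((Z l w)^*)%C) <=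
    J%:R^-2 * m%:R ^+ K * (D * r ^+ B).
  move=> jl; apply: le_trans (covB j l) _; rewrite ler_wpM2l ?mulr_ge0 //.
  apply: dec; rewrite -!mulnBl -mulnDl; apply: leq_pmull.
  by move: jl; rewrite -val_eqE /=; lia.
have [/andP[r0 _]] := r01.
have M0 : 0 <= J%:R^-2 * m%:R ^+ K * (D * r ^+ B).
  by rewrite !mulr_ge0 // exprn_ge0 // ltW.
apply: le_trans (second_moment_bound M0 diag off) _.
rewrite le_eqVlt; apply/orP; left; apply/eqP; field.
by rewrite lt0r_neq0.
Qed.

Lemma resonance_level_ge0 K J B : 0 <= resonance_level K J B.
Proof. by apply: sumr_ge0 => j _; rewrite mulr_ge0 ?invr_ge0 ?sqr_ge0. Qed.

Lemma resonance_lipschitz K J B x y : (0 < J)%N -> `|x - y| <= 1 ->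
  cnorm (resonance K J B x - resonance K J B y) <= 2 * pi * beta^-1 ^+ B.
Proof.
move=> J0 xy; have JR : 0 < J%:R :> R by rewrite ltr0n.
rewrite /resonance -sumrB; apply: le_trans (cnorm_sum _ _ _) _.
apply: (@le_trans _ _ (\sum_(j < J) J%:R^-1 * (2 * pi * beta^-1 ^+ B))).
  apply: ler_sum => j _; rewrite -!mulrBr cnormM cnorm_natV ler_wpM2l ?invr_ge0 //.
  rewrite cnormM cnorm_conj -[leRHS]mul1r; apply: ler_pM; rewrite ?cnorm_ge0 //.
    exact: mean_transform_le1.
  apply: le_trans (cexp_lipschitz _ _) _; rewrite ler_wpM2l ?mulr_ge0 ?pi_ge0 //.
  rewrite -mulrBr normrM -[leRHS]mulr1; apply: ler_pM => //.
  have bV : 0 <= beta^-1 by rewrite invr_ge0 ltW.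
  rewrite -exprVn ger0_norm ?exprn_ge0 //; apply: ler_wiXn2l => //.
    by rewrite invf_le1 // ltW.
  by rewrite mulSn leq_addr.
by rewrite sumr_const card_ord -[leLHS]mulr_natl mulrA mulfV ?mul1r // lt0r_neq0.
Qed.

Hypothesis not_dvd : ~ (exists b : nat, beta = b%:R /\ (b %| m)%N).

(** The parameters are chosen in the order J, B, K. A large J makes the diagonal
    contributions small, both on words and on the grid; then a large B makes the
    covariances small and the resonance nearly constant on the cells of the
    grid; M now depends on J and B only, and a large K makes it negligible
    compared with the number of cells, which is of order beta^K. *)
Lemma affinity_strict_bound : exists2 K : nat, (0 < K)%N &
  affinity beta m K < Num.sqrt (m%:R * beta) ^+ K.
Proof.
have [d d0 dP] := mean_transform_lower_bound beta_pisot lt_beta_m not_dvd.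
have [h [C [h0 h1 C0 grid]]] := grid_bound m beta_pisot.
have [D [r [/andP[r0 r1] D0 conc]]] := resonance_concentration.
pose t := (d ^+ 2 / 4) ^+ 2.
have t0 : 0 < t by rewrite exprn_gt0 // divr_gt0 // exprn_gt0.
have t3 : 0 < t / 3 by rewrite divr_gt0.
pose J := (Num.truncn (6 * C / t)).+1.
have JR : 0 < J%:R :> R by rewrite ltr0n.
have CJ : C * J%:R^-1 <= t / 6.
  have := truncnS_gt (6 * C / t); rewrite -/J ltr_pdivrMr // => hJ.
  by rewrite ler_pdivrMr // mulrAC ler_pdivlMr // mulrC [t * _]mulrC ltW.
have r01 : 0 <= r < 1 by rewrite (ltW r0).
have bV0 : 0 <= beta^-1 by rewrite invr_ge0 ltW.
have bV1 : beta^-1 < 1 by rewrite invf_lt1.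
have bV : 0 <= beta^-1 < 1 by rewrite bV0.
have [B1 HB1] := geometric_eventually_small (C * D) r01 t3.
have [B2 HB2] := geometric_eventually_small (2 * C * (2 * pi) ^+ 2) bV t3.
pose B := (maxn B1 B2).+1.
have {}HB1 : C * D * r ^+ B <= t / 3 by apply: HB1; rewrite ltnW // ltnS leq_maxl.
have {}HB2 : 2 * C * (2 * pi) ^+ 2 * beta^-1 ^+ B <= t / 3.
  by apply: HB2; rewrite ltnW // ltnS leq_maxr.
pose xi (j : 'I_J) : R := beta ^- (j.+1 * B) * h.
have xi_sep (j l : 'I_J) : j != l -> 0 < `|xi j - xi l| < 1.
  have lt_xi (a b : 'I_J) : (a < b)%N -> 0 < xi b < xi a.
    move=> ab; rewrite /xi -!exprVn mulr_gt0 ?exprn_gt0 ?invr_gt0 //=.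
    by rewrite ltr_pM2r // ltr_iXn2l ?invr_gt0 // ltn_mul2r /B.
  have xi1 (a : 'I_J) : xi a < 1.
    rewrite /xi -exprVn; apply: le_lt_trans (_ : beta^-1 ^+ (a.+1 * B) < 1).
      by rewrite ler_piMr ?exprn_ge0.
    by rewrite exprn_ilt1 // muln_eq0.
  rewrite neq_ltn => /orP[] /lt_xi /andP[p1 p2].
    by rewrite gtr0_norm ?subr_gt0 // p2 /=; have := xi1 j; lra.
  by rewrite ltr0_norm ?subr_lt0 // opprB subr_gt0 p2 /=; have := xi1 l; lra.
have [M M0 expgrid] := exponential_sum_grid (isT : (0 < J)%N) xi_sep.
have [K0 HK0] := geometric_eventually_small (2 * M) bV t3.
pose K := (maxn K0 (J * B)).+1.
have {}HK0 : 2 * M * beta^-1 ^+ K <= t / 3.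
  by apply: HK0; rewrite ltnW // ltnS leq_maxl.
have bK : 0 < beta ^+ K by rewrite exprn_gt0.
have mK : 0 < m%:R ^+ K :> R by rewrite exprn_gt0 // ltr0n.
exists K => //.
pose S (w : K.-tuple 'I_m) := resonance K J B (word_value beta w).
pose Sg (i : nat) := resonance K J B (h * i%:R).
pose kappa := resonance_level K J B.
have kappa_ge : d ^+ 2 <= kappa.
  apply: (@le_trans _ _ (\sum_(j < J) J%:R^-1 * d ^+ 2)).
    by rewrite sumr_const card_ord -[leRHS]mulr_natl mulrA mulfV ?mul1r // lt0r_neq0.
  apply: ler_sum => j _; rewrite ler_wpM2l ?invr_ge0 //.
  rewrite lerXn2r ?nnegrE ?cnorm_ge0 ?(ltW d0) //; apply: dP.
  rewrite ltnW // ltnS (leq_trans _ (leq_maxr _ _)) //.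
  by rewrite leq_mul2r ltn_ord orbT.
have [N NC gridN] := grid K.
pose a (w : K.-tuple 'I_m) : R := (Num.sqrt (multiplicity beta w)%:R)^-1.
have a2 w : a w ^+ 2 = (multiplicity beta w)%:R^-1.
  by rewrite /a exprVn sqr_sqrtr.
have a0 w : 0 <= a w by rewrite invr_ge0 sqrtr_ge0.
have sum_a2 : \sum_w a w ^+ 2 <= C * beta ^+ K.
  apply: le_trans NC; have := gridN (fun=> 1) (fun=> ler01).
  rewrite sumr_const card_ord; apply: le_trans.
  by apply: ler_sum => w _; rewrite mulr1 a2.
have sum1 : \sum_(w : K.-tuple 'I_m) (1 : R) ^+ 2 = m%:R ^+ K.
  by rewrite expr1n sumr_const card_tuple card_ord natrX.
have sqrtQ : Num.sqrt (m%:R * beta) ^+ K = Num.sqrt (m%:R ^+ K * beta ^+ K).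
  rewrite -[LHS]ger0_norm ?exprn_ge0 ?sqrtr_ge0 // -sqrtr_sqr -exprM mulnC exprM.
  by rewrite sqr_sqrtr ?exprMn // mulr_ge0 // ltW.
have sqrtQt : Num.sqrt (m%:R ^+ K * beta ^+ K * t) =
    Num.sqrt (m%:R * beta) ^+ K * (d ^+ 2 / 4).
  rewrite sqrtrM ?mulr_ge0 ?(ltW mK) ?(ltW bK) // -sqrtQ /t sqrtr_sqr.
  by rewrite ger0_norm // divr_ge0 // sqr_ge0.
(* Cauchy-Schwarz: the sum of 1/c is O(beta^K), and S is concentrated near
   kappa. *)
have part1 : \sum_w a w * cnorm (kappa%:C%C - S w) <=
    Num.sqrt (m%:R * beta) ^+ K * (d ^+ 2 / 4).
  apply: le_trans (sum_cauchy_schwarz _ _) _; rewrite -sqrtQt -sqrtrM; last first.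
    by apply: sumr_ge0 => w _; apply: sqr_ge0.
  apply: ler_wsqrtr.
  have c2 := conc K J B isT.
  apply: (@le_trans _ _ ((C * beta ^+ K) * (m%:R ^+ K * (J%:R^-1 + D * r ^+ B)))).
    by apply: ler_pM => //; apply: sumr_ge0 => w _; apply: sqr_ge0.
  rewrite (_ : _ * _ = m%:R ^+ K * beta ^+ K *
    (C * J%:R^-1 + C * D * r ^+ B)); last by ring.
  by rewrite ler_wpM2l ?mulr_ge0 ?(ltW mK) ?(ltW bK) //; lra.
(* Cauchy-Schwarz: there are m^K words, and the sum of |S|^2 / c is small since
   S is small on the grid. *)
have part2 : \sum_w a w * cnorm (S w) <=
    Num.sqrt (m%:R * beta) ^+ K * (d ^+ 2 / 4).
  have := @sum_cauchy_schwarz R _ (fun w => a w * cnorm (S w)) (fun=> 1).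
  under eq_bigr => w _ do rewrite mulr1.
  move/le_trans; apply; rewrite sum1 -sqrtQt -sqrtrM; last first.
    by apply: sumr_ge0 => w _; apply: sqr_ge0.
  apply: ler_wsqrtr; rewrite -mulrA mulrC ler_wpM2l ?(ltW mK) //.
  pose tau := 2 * pi * beta^-1 ^+ B.
  have near_grid w : cnorm (S w) ^+ 2 <=
      2 * cnorm (Sg (Num.truncn (word_value beta w / h))) ^+ 2 + 2 * tau ^+ 2.
    set i := Num.truncn _.
    have : cnorm (S w - Sg i) <= tau.
      apply: resonance_lipschitz => //; apply: le_trans h1.
      have v0 : 0 <= word_value beta w / h.
        by rewrite divr_ge0 ?word_value_ge0 // ltW.
      have /andP[lo hi] := truncn_itv v0.
      rewrite ler_pdivlMr // mulrC in lo; rewrite ltr_pdivrMr // -natr1 mulrDl in hi.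
      by rewrite ger0_norm ?subr_ge0 // lerBlDl mulrC -[X in _ + X]mul1r ltW.
    have := cnormD (S w - Sg i) (Sg i); rewrite subrK.
    have := cnorm_ge0 (S w); have := cnorm_ge0 (Sg i); have := cnorm_ge0 (S w - Sg i).
    move: (cnorm (S w)) (cnorm (Sg i)) (cnorm (S w - Sg i)) => x y z z0 y0 x0 xyz zt.
    have : x ^+ 2 <= (y + tau) ^+ 2 by rewrite lerXn2r ?nnegrE //; lra.
    have := sqr_ge0 (y - tau); rewrite !expr2; lra.
  apply: (@le_trans _ _ (\sum_(i < N) (2 * cnorm (Sg i) ^+ 2 + 2 * tau ^+ 2))).
    have G0 i : 0 <= 2 * cnorm (Sg i) ^+ 2 + 2 * tau ^+ 2.
      by rewrite addr_ge0 // mulr_ge0 // sqr_ge0.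
    apply: le_trans (gridN _ G0); apply: ler_sum => w _.
    by rewrite exprMn a2 ler_wpM2l ?invr_ge0.
  rewrite big_split /= -mulr_sumr sumr_const card_ord.
  have SgE : \sum_(i < N) cnorm (Sg i) ^+ 2 <= N%:R / J%:R + M.
    pose c (j : 'I_J) := ((mean_transform beta m K (beta ^- (j.+1 * B)))^*)%C.
    have c1 j : cnorm (c j) <= 1 by rewrite cnorm_conj mean_transform_le1.
    apply: le_trans (expgrid N c c1); apply: ler_sum => i _.
    rewrite le_eqVlt; apply/orP; left; apply/eqP.
    congr (cnorm _ ^+ 2); apply: eq_bigr => j _.
    have -> // : xi j * i%:R = beta ^- (j.+1 * B) * (h * i%:R) by rewrite /xi mulrA.
  have tau2 : tau ^+ 2 <= (2 * pi) ^+ 2 * beta^-1 ^+ B.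
    rewrite /tau exprMn ler_wpM2l ?sqr_ge0 // expr2.
    by rewrite ler_piMr ?exprn_ge0 // exprn_ile1 // ltW.
  have NJ : N%:R / J%:R <= beta ^+ K * (t / 6).
    rewrite ler_pdivrMr //; apply: le_trans NC _.
    rewrite mulrC -mulrA ler_wpM2l ?(ltW bK) //.
    by move: CJ; rewrite ler_pdivrMr.
  have NT : N%:R * (2 * tau ^+ 2) <= beta ^+ K * (t / 3).
    apply: (@le_trans _ _ (C * beta ^+ K * (2 * ((2 * pi) ^+ 2 * beta^-1 ^+ B)))).
      by apply: ler_pM => //; [rewrite mulr_ge0 // sqr_ge0 | apply: ler_wpM2l].
    rewrite (_ : _ * _ = beta ^+ K *
      (2 * C * (2 * pi) ^+ 2 * beta^-1 ^+ B)); last by ring.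
    by rewrite ler_wpM2l // ltW.
  have MT : 2 * M <= beta ^+ K * (t / 3).
    move: HK0; rewrite exprVn ler_pdivrMr // [_ * beta ^+ K]mulrC; exact.
  rewrite -[X in _ + X <= _]mulr_natl; lra.
have total : kappa * affinity beta m K <=
    Num.sqrt (m%:R * beta) ^+ K * (d ^+ 2 / 4) +
    Num.sqrt (m%:R * beta) ^+ K * (d ^+ 2 / 4).
  apply: le_trans (lerD part1 part2); rewrite mulrC mulr_suml -big_split /=.
  apply: ler_sum => w _; rewrite -mulrDr; apply: ler_wpM2l; first exact: a0.
  rewrite -[leLHS](ger0_norm (resonance_level_ge0 K J B)) -cnorm_real.
  by rewrite -[X in cnorm X <= _](subrK (S w)); apply: cnormD.
have Q0 : 0 < Num.sqrt (m%:R * beta) ^+ K.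
  by rewrite exprn_gt0 // sqrtr_gt0 mulr_gt0 // ltr0n.
have d20 : 0 < d ^+ 2 by rewrite exprn_gt0.
have : d ^+ 2 * affinity beta m K <= d ^+ 2 * (Num.sqrt (m%:R * beta) ^+ K / 2).
  apply: (@le_trans _ _ (kappa * affinity beta m K)).
    by rewrite ler_wpM2r // affinity_ge0.
  by apply: le_trans total _; lra.
rewrite ler_pM2l //; lra.
Qed.

End StrictBound.

(** * Growth rates *)

Lemma ln_sqrt_ratio (R : realType) (beta mu : R) (K : nat) :
  0 < beta -> 0 < mu ->
  2 * ln (Num.sqrt (mu * beta) ^+ K / beta ^+ K) = K%:R * ln (mu / beta).
Proof.
move=> b0 mu0; have x0 : 0 < Num.sqrt (mu * beta) / beta.
  by rewrite divr_gt0 // sqrtr_gt0 mulr_gt0.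
have -> : mu / beta = (Num.sqrt (mu * beta) / beta) ^+ 2.
  rewrite exprMn sqr_sqrtr ?mulr_ge0 ?ltW //; field.
  by rewrite gt_eqF.
rewrite -exprVn -exprMn !lnXn //.
by set y := ln _; rewrite -(mulr_natl y K) -(mulr_natl y 2) mulrCA.
Qed.

Theorem theorem1p3 (R : realType) (beta : R) (m : nat) (gamma : R)
    (beta_pisot : pisot beta) (lt_beta_m : beta < m%:R)
    (gamma_gt0 : 0 < gamma) (gammaP : is_growth_rate beta m gamma) :
  ((exists b : nat, beta = b%:R /\ (b %| m)%N) ->
     gamma = ln (m%:R / beta)) /\
  (~ (exists b : nat, beta = b%:R /\ (b %| m)%N) ->
     gamma < ln (m%:R / beta)).
Proof.
have beta1 := pisot_gt1 beta_pisot.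
have b0 : 0 < beta by apply: lt_trans beta1.
have mR : 0 < m%:R :> R by apply: lt_trans lt_beta_m.
have s0 : 0 < Num.sqrt (m%:R * beta) by rewrite sqrtr_gt0 mulr_gt0.
split=> [[b [Eb bm]]|not_dvd].
  have [C _ HC] := affinity_bound m beta_pisot.
  apply/le_anti/andP; split.
    have aff j : affinity beta m (j * 1) <= C * Num.sqrt (m%:R * beta) ^+ j.
      by rewrite muln1; apply: HC.
    have := growth_rate_upper_bound beta1 lt_beta_m gamma_gt0 gammaP (ltn0Sn 0) s0 aff.
    by rewrite mul1r -[Num.sqrt _]expr1 ln_sqrt_ratio // mul1r.
  have b1 : (1 < b)%N by rewrite -(ltr_nat R) -Eb.
  move/dvdnP: bm => [q mE].
  have q0 : (0 < q)%N by move: mR; rewrite mE ltr0n muln_gt0 => /andP[].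
  have : is_growth_rate (b%:R : R) (b * q) gamma by rewrite mulnC -mE -Eb.
  move/(integer_base_growth_rate b1 q0); apply: le_trans.
  by rewrite mE natrM Eb mulfK // pnatr_eq0 -lt0n (ltn_trans _ b1).
have [K K0 affK] := affinity_strict_bound beta_pisot lt_beta_m not_dvd.
have KR : 0 < K%:R :> R by rewrite ltr0n.
pose Theta := (affinity beta m K + Num.sqrt (m%:R * beta) ^+ K) / 2.
have aK0 := affinity_ge0 beta m K.
have sK0 : 0 < Num.sqrt (m%:R * beta) ^+ K by rewrite exprn_gt0.
have [T0 [aT Ts]] : 0 < Theta /\ affinity beta m K <= Theta /\
    Theta < Num.sqrt (m%:R * beta) ^+ K.
  by rewrite /Theta; split; [|split]; lra.
(* The midpoint Theta is positive and still below (m beta)^(K/2). *)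
have aff j : affinity beta m (j * K) <= 1 * Theta ^+ j.
  rewrite mul1r; apply: le_trans (affinity_iter beta m K j) _.
  by rewrite lerXn2r ?nnegrE // ltW.
have := growth_rate_upper_bound beta1 lt_beta_m gamma_gt0 gammaP K0 T0 aff.
move=> h; rewrite -(ltr_pM2l KR) -ln_sqrt_ratio //; apply: le_lt_trans h _.
have bK : 0 < beta ^+ K by rewrite exprn_gt0.
rewrite ltr_pM2l // ltr_ln;
  [|by rewrite posrE divr_gt0..].
by rewrite ltr_pM2r // invr_gt0.
Qed.
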